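(* For every integer $r\ge 1$ there exists a topologically $2r$-chromatic graph $G$ with local chromatic number $\psi(G)=r+1$, where this value can be attained by a $(2r+1)$-coloring (i.e. there is a proper coloring $c$ of $G$ using $2r+1$ colors with $\max_{v\in V(G)}|\{c(u):u\in N(v)\}|+1=r+1$). In particular, topological $2r$-chromaticity implies neither strong topological $2r$-chromaticity nor that the local chromatic number is at least $r+2$.
   Context: Graphs are finite and simple. The local chromatic number of a graph $G$ is $\psi(G):=\min_c\max_{v\in V(G)}|\{c(u):u\in N(v)\}|+1$, where $c$ ranges over all proper colorings of $G$ (with any number of colors) and $N(v)$ is the set of neighbors of $v$. A $\mathbb Z_2$-space is a topological space with a continuous involution; a $\mathbb Z_2$-map is a continuous map commuting with the involutions. The unit sphere $\mathbb S^d\subset\mathbb R^{d+1}$ carries the involution $x\mapsto -x$. The coindex of a $\mathbb Z_2$-space $T$ is $\mathrm{coind}(T)=\max\{d\ge 0:\text{there is a }\mathbb Z_2\text{-map }\mathbb S^d\to T\}$ ($\infty$ if such maps exist for all $d$). The box complex $B_0(G)$ is the simplicial complex on the vertex set $V(G)\times\{1,2\}$ whose members are the sets $S\uplus T:=S\times\{1\}\cup T\times\{2\}$ with $S,T\subseteq V(G)$, $S\cap T=\emptyset$, and every vertex of $S$ adjacent in $G$ to every vertex of $T$ (one or both of $S,T$ may be empty). Let $\|B_0(G)\|$ be its geometric realization, with the $\mathbb Z_2$-structure induced by swapping $(v,1)$ and $(v,2)$ for all $v$. The hom space $H(G)$ is the $\mathbb Z_2$-subspace of $\|B_0(G)\|$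 consisting of those points whose representation $p=\sum_x\alpha_x\|x\|$ as a convex combination of the vertices of a simplex satisfies $\sum_{v\in V(G)}\alpha_{(v,1)}=1/2$. $G$ is topologically $t$-chromatic if $\mathrm{coind}(\|B_0(G)\|)\ge t-1$, and strongly topologically $t$-chromatic if $\mathrm{coind}(H(G))\ge t-2$.
   Formalization: The claim that topological 2r-chromaticity does not imply strong topological 2r-chromaticity is stated for r ≥ 2 only; for r = 1 it is false, since coind of the box complex ≥ 1 forces an edge, and an edge makes H(G) nonempty, so its coindex is ≥ 0. *)

(* Defs.v *)
From HB Require Import structures.
From mathcomp Require Import all_boot all_order all_algebra.
From mathcomp Require Import all_classical all_reals all_analysis.
From mathcomp Require Import lra.
Import Order.TTheory GRing.Theory Num.Theory.
Import numFieldNormedType.Exports.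

Set Implicit Arguments.
Unset Strict Implicit.
Unset Printing Implicit Defensive.

Local Open Scope classical_set_scope.
Local Open Scope ring_scope.

Record sgraph := SGraph {
  vertex :> finType;
  adj : rel vertex;
  adj_sym : symmetric adj;
  adj_irr : irreflexive adj }.

(* Colors are natural numbers: V(G) being finite, this allows any number of
   colors. *)
Definition proper_coloring (G : sgraph) (c : G -> nat) : Prop :=
  forall u v : G, adj u v -> c u <> c v.

Definition num_colors (G : sgraph) (c : G -> nat) : nat :=
  size (undup [seq c u | u <- enum G]).

Definition nbr_colors (G : sgraph) (c : G -> nat) (v : G) : nat :=
  size (undup [seq c u | u <- enum G & adj v u]).

Definition local_value (G : sgraph) (c : G -> nat) : nat :=
  (\max_(v : G) nbr_colors c v).+1.

Definition local_value_attained (G : sgraph) : pred nat :=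
  fun k => `[< exists c : G -> nat, proper_coloring c /\ local_value c = k >].

Lemma local_value_attained_ex (G : sgraph) :
  exists k, local_value_attained G k.
Proof.
exists (local_value (fun v : G => nat_of_ord (enum_rank v))); apply/asboolP.
exists (fun v : G => nat_of_ord (enum_rank v)); split=> // u v uv.
by move=> /ord_inj/enum_rank_inj uv'; move: uv; rewrite uv' adj_irr.
Qed.

Definition local_chromatic_number (G : sgraph) : nat :=
  ex_minn (local_value_attained_ex G).

Record z2space := Z2Space {
  z2carrier :> topologicalType;
  z2inv : z2carrier -> z2carrier;
  z2inv_continuous : continuous z2inv;
  z2invK : involutive z2inv }.

Definition is_z2map (S T : z2space) (f : S -> T) : Prop :=
  continuous f /\ forall x, f (z2inv x) = z2inv (f x).

Section Sub.
Variables (T : z2space) (A : set T).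
Hypothesis AP : forall x, A x -> A (z2inv x).

Definition sub_inv (x : A) : A :=
  SigSub (mem_set (AP (set_valP x))).

Lemma sub_invK : involutive sub_inv.
Proof. by move=> x; apply: val_inj; rewrite /= z2invK. Qed.

Lemma sub_inv_continuous : continuous sub_inv.
Proof.
apply: continuous_comp_initial => x.
apply: (@continuous_comp A T T set_val (@z2inv T)).
  exact: initial_continuous.
exact: z2inv_continuous.
Qed.

Definition sub_z2space : z2space :=
  @Z2Space A sub_inv sub_inv_continuous sub_invK.
End Sub.

Section Sphere.
Variables (R : realType) (d : nat).

Definition euclidean_z2space : z2space :=
  @Z2Space 'rV[R]_d.+1 -%R (@oppr_continuous _ _) (@opprK _).

Definition sphere_set : set euclidean_z2space :=
  [set x : 'rV[R]_d.+1 | \sum_(i < d.+1) x 0 i ^+ 2 = 1].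

Lemma sphere_setN x : sphere_set x -> sphere_set (z2inv x).
Proof.
move=> Sx; rewrite /sphere_set /= -[RHS]Sx.
by apply: eq_bigr => i _; rewrite mxE sqrrN.
Qed.

Definition sphere : z2space := sub_z2space sphere_setN.
End Sphere.

(* The supremum of the (downward closed) set of admissible dimensions: the
   maximum when the set is bounded, +oo when maps exist for all d, and -oo when
   there is none, i.e. when T is empty. *)
Definition coind (R : realType) (T : z2space) : \bar R :=
  ereal_sup [set d%:R%:E | d in
    [set d : nat | exists f : sphere R d -> T, is_z2map f]].

Lemma ptws_continuous (I : eqType) (X T : topologicalType)
    (f : X -> {ptws I -> T}) :
  (forall i, continuous (fun x => f x i)) -> continuous f.
Proof.
move=> fc x; apply/cvg_sup => i U [/= _ [[V oV <-] /= Vfx]] /filterS; apply.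
exact/fc/open_nbhs_nbhs.
Qed.

Section GeometricRealization.
Variables (R : realType) (W : finType).

(* Points are given by their barycentric coordinates; as W is finite, the
   topology is the one induced by the product topology on R^W. *)
Definition realization_set (K : {set {set W}}) : set {ptws W -> R} :=
  [set a : {ptws W -> R} | exists2 X, X \in K &
    [/\ forall x, x \in X -> 0 <= a x,
        forall x, x \notin X -> a x = 0 &
        \sum_(x in X) a x = 1]].

Variables (s : W -> W) (sK : involutive s).

Definition coord_act (a : {ptws W -> R}) : {ptws W -> R} := fun x => a (s x).

Lemma coord_actK : involutive coord_act.
Proof. by move=> a; apply: funext => x; rewrite /coord_act sK. Qed.

Lemma coord_act_continuous : continuous coord_act.
Proof.
apply: ptws_continuous => x.
exact: (@proj_continuous W (fun=> R) (s x)).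
Qed.

Definition coord_z2space : z2space :=
  @Z2Space {ptws W -> R} coord_act coord_act_continuous coord_actK.

Variable K : {set {set W}}.
Hypothesis sKK : forall X, X \in K -> (s @: X)%SET \in K.

Lemma realization_set_inv (a : coord_z2space) :
  realization_set K a -> realization_set K (z2inv a).
Proof.
have s_inj : injective s := inv_inj sK.
have ms (X : {set W}) x : (x \in (s @: X)%SET) = (s x \in X).
  by rewrite (can_imset_pre X sK) inE.
case=> X XK [a0 aN a1]; exists (s @: X)%SET; first exact: sKK.
split=> [x|x|]; rewrite ?ms.
- exact: a0.
- exact: aN.
- rewrite (big_imset _ (in2W s_inj)) /= -[RHS]a1.
  by apply: eq_bigr => x _; rewrite /coord_act sK.
Qed.

Definition realization : z2space :=
  @sub_z2space coord_z2space (realization_set K) realization_set_inv.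
End GeometricRealization.

Section BoxComplex.
Variable G : sgraph.

(* (v, false) and (v, true) stand for (v, 1) and (v, 2). *)
Definition uplus (S T : {set G}) : {set G * bool} :=
  (finset.setX S [set false] :|: finset.setX T [set true])%SET.

Definition box_complex : {set {set G * bool}} :=
  [set X | [exists S : {set G}, exists T : {set G},
    [&& X == uplus S T, [disjoint S & T] &
        [forall u in S, forall v in T, adj u v]]]]%SET.

Definition swap (x : G * bool) : G * bool := (x.1, ~~ x.2).

Lemma swapK : involutive swap.
Proof. by case=> v b; rewrite /swap /= negbK. Qed.

Lemma swap_uplus (S T : {set G}) : (swap @: uplus S T)%SET = uplus T S.
Proof.
apply/setP => -[v b]; rewrite (can_imset_pre _ swapK).
by rewrite !inE /swap /=; case: b; rewrite !(andbT, andbF, orbF).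
Qed.

Lemma swap_box_complex X : X \in box_complex -> (swap @: X)%SET \in box_complex.
Proof.
rewrite !inE => /existsP[S /existsP[T /and3P[/eqP-> ST /forall_inP adjST]]].
apply/existsP; exists T; apply/existsP; exists S.
rewrite swap_uplus eqxx disjoint_sym ST /=.
apply/forall_inP => u uT; apply/forall_inP => v vS.
by rewrite adj_sym; exact: (forall_inP (adjST v vS)).
Qed.

Variable R : realType.

Definition box_space : z2space :=
  @realization R (G * bool)%type swap swapK box_complex swap_box_complex.

Definition barycoord (p : box_space) : G * bool -> R := set_val p.

Definition hom_set : set box_space :=
  [set p | \sum_(v : G) barycoord p (v, false) = 1 / 2].

Lemma hom_set_inv p : hom_set p -> hom_set (z2inv p).
Proof.
have : \sum_(x : G * bool) barycoord p x = 1.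
  case: (set_valP p) => X _ [_ aN a1]; rewrite -[RHS]a1 [RHS]big_mkcond /=.
  by apply: eq_bigr => x _; case: ifPn => // /aN.
have -> : \sum_(x : G * bool) barycoord p x =
    \sum_(v : G) barycoord p (v, false) + \sum_(v : G) barycoord p (v, true).
  rewrite -big_split /= (eq_bigr (fun v => \sum_(b : bool) barycoord p (v, b))).
    by rewrite pair_big /=; apply: eq_bigr => -[].
  by move=> v _; rewrite big_bool /= addrC.
rewrite /hom_set /= => + p2; rewrite p2 => /(canRL (addKr _)) p2'.
by rewrite [LHS]p2'; lra.
Qed.

Definition hom_space : z2space := sub_z2space hom_set_inv.
End BoxComplex.

Definition topologically_chromatic (R : realType) (t : nat) (G : sgraph) :
    Prop :=
  ((t%:R - 1)%:E <= coind R (box_space G R))%E.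

Definition strongly_topologically_chromatic (R : realType) (t : nat)
    (G : sgraph) : Prop :=
  ((t%:R - 2)%:E <= coind R (hom_space G R))%E.

(* Main.v *)
Require Import Defs.
From HB Require Import structures.
From mathcomp Require Import all_boot all_order all_algebra.
From mathcomp Require Import all_classical all_reals all_analysis.
From mathcomp Require Import zify ring lra.
Import Order.TTheory GRing.Theory Num.Theory.
Import numFieldNormedType.Exports.

(** The topological input is the Borsuk-Ulam theorem in the following form: a
    continuous map from the cube of dimension n to a real vector space of
    dimension n, odd on the unit sphere of the l1 norm, has a zero
    (borsuk_ulam_ball). It comes from a parity count: in a triangulation of the
    ball of that norm whose boundary is antipodally symmetric, an odd number of
    n-simplices have vertices x_0, ..., x_n such that each coordinate of the map
    changes sign between two prescribed consecutive vertices
    (odd_sign_changes). In a fine triangulation all the coordinates are then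
    small at such a simplex.

    If c is a proper coloring of a topologically 2r-chromatic graph, a point of
    the box complex determines a signed measure on the colors, which changes sign
    under the involution. By Borsuk-Ulam, some point has a measure with vanishing
    moments of orders 0 to 2r - 2. If all vertices saw fewer than r colors, the
    negative part of that measure would live on at most r - 1 colors, and the
    square of the polynomial vanishing there would contradict the vanishing of
    the moments (topologically_chromatic_nbr_colors). So the local chromatic
    number is at least r + 1.

    The graphs come from a family of losing subsets of a set of 2r + 1 colors,
    closed under inclusion and containing exactly one of any two complementary
    sets. A vertex is a pair (i, A) of a color and a set of colors, and (i, A),
    (j, B) are adjacent when i is in B but not in A, j is in A but not in B, and
    A and B are losing. Every real function x on the colors has a unique pivot h
    such that the sets where x > h and where x < h are losing; h is the median
    when the losing sets are those with at most r elements. The function x - h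
    vanishes only if x is constant, so it gives an odd map from a sphere of
    dimension 2r - 1 to the functions whose positive and negative parts have
    losing supports, and these functions are turned into points of the box
    complex: on the side of the positive values, the second component of a vertex
    is squeezed between the set of very negative colors and that of negative
    colors, and symmetrically on the other side (selfdual_graph_coind). For the sets with at most r elements, the color of
    (i, A) is i, and its neighbors have their colors in A: the local chromatic
    number is r + 1.

    For the second claim another family is used. A point of the hom space still
    gives a nonzero function on the colors with positive and negative parts of
    losing supports, but now with equal masses. The losing sets are chosen so that
    these functions run through a handle, along which a nonvanishing complex
    function of them winds around the origin. On a ball of dimension 2r - 2 this
    complex function has a continuous square root, which twists the coordinates
    into an odd map to a space of dimension 2r - 2 without zeros
    (no_balanced_map). So the hom space receives no equivariant map from the
    sphere of dimension 2r - 2. *)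

Set Implicit Arguments.
Unset Strict Implicit.
Unset Printing Implicit Defensive.

Local Open Scope classical_set_scope.
Local Open Scope ring_scope.

(** * Continuity of real functions *)

Section ContinuousRealFunctions.
Variables (R : realType) (T : topologicalType).
Implicit Types f g : T -> R.

Lemma cont_cst (a : R) : continuous (fun _ : T => a).
Proof. exact: cst_continuous. Qed.

Lemma cont_add f g : continuous f -> continuous g ->
  continuous (fun x => f x + g x).
Proof. by move=> cf cg x; apply: cvgD; [exact: cf|exact: cg]. Qed.

Lemma cont_opp f : continuous f -> continuous (fun x => - f x).
Proof. by move=> cf x; apply: cvgN; exact: cf. Qed.

Lemma cont_sub f g : continuous f -> continuous g ->
  continuous (fun x => f x - g x).
Proof. by move=> cf cg; apply: cont_add => //; exact: cont_opp. Qed.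

Lemma cont_mul f g : continuous f -> continuous g ->
  continuous (fun x => f x * g x).
Proof. by move=> cf cg x; apply: cvgM; [exact: cf|exact: cg]. Qed.

Lemma cont_exp f k : continuous f -> continuous (fun x => f x ^+ k).
Proof.
move=> cf; elim: k => [|k IH]; first exact: cont_cst.
have -> : (fun x => f x ^+ k.+1) = (fun x => f x * f x ^+ k).
  by apply/funext => x; rewrite exprS.
exact: cont_mul.
Qed.

Lemma cont_inv f : continuous f -> (forall x, f x != 0) ->
  continuous (fun x => (f x)^-1).
Proof. by move=> cf f0 x; apply: cvgV; [exact: f0|exact: cf]. Qed.

Lemma cont_norm f : continuous f -> continuous (fun x => `|f x|).
Proof.
move=> cf x; apply: (@continuous_comp _ _ _ f (fun z : R => `|z|)).
  exact: cf.
exact: norm_continuous.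
Qed.

Lemma cont_sqrt f : continuous f -> continuous (fun x => Num.sqrt (f x)).
Proof.
move=> cf x; apply: (@continuous_comp _ _ _ f Num.sqrt); first exact: cf.
exact: sqrt_continuous.
Qed.

Lemma cont_maxr f g : continuous f -> continuous g ->
  continuous (fun x => Num.max (f x) (g x)).
Proof.
move=> cf cg.
have -> : (fun x => Num.max (f x) (g x)) =
    (fun x => (f x + g x + `|f x - g x|) / 2).
  by apply/funext => x; rewrite maxr_absE.
apply: cont_mul; last exact: cont_cst.
by apply: cont_add; [exact: cont_add|apply/cont_norm/cont_sub].
Qed.

Lemma cont_sum (I : Type) (r : seq I) (P : pred I) (F : I -> T -> R) :
  (forall i, P i -> continuous (F i)) ->
  continuous (fun x => \sum_(i <- r | P i) F i x).
Proof. by apply: continuous_big; exact: add_continuous. Qed.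

Lemma cont_prod (I : Type) (r : seq I) (P : pred I) (F : I -> T -> R) :
  (forall i, P i -> continuous (F i)) ->
  continuous (fun x => \prod_(i <- r | P i) F i x).
Proof. by apply: continuous_big; exact: mul_continuous. Qed.

End ContinuousRealFunctions.

Lemma cont_row (R : realType) (T : topologicalType) n (F : 'I_n -> T -> R) :
  (forall j, continuous (F j)) -> continuous (fun x => \row_j F j x).
Proof.
move=> cF x; apply/cvg_ballP => e e0.
have : \forall y \near x, forall j, ball (F j x) e (F j y).
  apply: filter_forall => j; have /cvg_ballP := cF j x; exact.
apply: filterS => y yF; split=> // i j.
by rewrite !mxE; exact: yF.
Qed.

Lemma cont_coord (R : realType) (T : topologicalType) n (f : T -> 'rV[R]_n) j :
  continuous f -> continuous (fun x => f x 0 j).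
Proof.
move=> cf x; apply: (@continuous_comp _ _ _ f (fun z : 'rV_n => z 0 j)).
  exact: cf.
exact: coord_continuous.
Qed.

(** * Mod 2 chains of tuples of points *)

Section Chains.
Variable V : eqType.
Implicit Types (s t u : seq V) (c : seq (seq V)) (phi psi : seq V -> bool).

Fixpoint bdry s : seq (seq V) :=
  if s is x :: t then t :: [seq x :: u | u <- bdry t] else [::].

(** Chains are lists of tuples, compared only through the values of all cochains
    on them, which are computed mod 2: this makes repeated tuples cancel. *)
Definition ev phi c : bool := \big[addb/false]_(s <- c) phi s.

Definition coboundary phi s : bool := ev phi (bdry s).

Definition extend (g : seq V -> seq (seq V)) c := flatten [seq g s | s <- c].

Lemma ev_nil phi : ev phi [::] = false.
Proof. by rewrite /ev big_nil. Qed.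

Lemma ev_cons phi s c : ev phi (s :: c) = phi s (+) ev phi c.
Proof. by rewrite /ev big_cons. Qed.

Lemma ev_cat phi c c' : ev phi (c ++ c') = ev phi c (+) ev phi c'.
Proof. by rewrite /ev big_cat. Qed.

Lemma ev_map phi (g : seq V -> seq V) c :
  ev phi [seq g s | s <- c] = ev (fun s => phi (g s)) c.
Proof. by rewrite /ev big_map. Qed.

Lemma ev_extend phi g c : ev phi (extend g c) = ev (fun s => ev phi (g s)) c.
Proof. by rewrite /ev big_flatten big_map. Qed.

Lemma ev_addb phi psi c :
  ev (fun s => phi s (+) psi s) c = ev phi c (+) ev psi c.
Proof. by rewrite /ev big_split. Qed.

Lemma ev_false c : ev (fun=> false) c = false.
Proof. by rewrite /ev big1. Qed.

Lemma ev_andl (b : bool) phi c : ev (fun s => b && phi s) c = b && ev phi c.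
Proof. by case: b => //; exact: ev_false. Qed.

Lemma eq_ev phi psi c : {in c, phi =1 psi} -> ev phi c = ev psi c.
Proof. by move=> eqc; rewrite /ev big_seq [RHS]big_seq; exact: eq_bigr. Qed.

Lemma ev_true phi c : ev phi c -> exists2 s, s \in c & phi s.
Proof.
move=> evc; apply/hasP; apply: contraTT evc => /hasPn nphi.
by rewrite (eq_ev (psi := fun=> false)) ?ev_false// => s /nphi/negbTE.
Qed.

Lemma coboundary_cons phi x t :
  coboundary phi (x :: t) = phi t (+) coboundary (fun u => phi (x :: u)) t.
Proof. by rewrite /coboundary /= ev_cons ev_map. Qed.

Lemma ev_coboundary_bdry phi s : ev (coboundary phi) (bdry s) = false.
Proof.
elim: s phi => [|x t IH] phi; first by rewrite ev_nil.
rewrite /= ev_cons ev_map (eq_ev (psi := fun u => phi u (+)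
  coboundary (fun v => phi (x :: v)) u)) => [|u _].
  by rewrite ev_addb IH addbF addbb.
exact: coboundary_cons.
Qed.

Lemma size_bdry s u : u \in bdry s -> size u = (size s).-1.
Proof.
elim: s u => [|x t IH] u //=; rewrite inE => /predU1P[->//|].
by case/mapP => v vt -> /=; rewrite (IH _ vt); case: t vt {IH}.
Qed.

Lemma bdry_sub s u : u \in bdry s -> {subset u <= s}.
Proof.
elim: s u => [|y t IH] u //=; rewrite inE => /predU1P[-> x xt|].
  by rewrite inE xt orbT.
case/mapP => v vt -> x; rewrite !inE => /predU1P[->|/(IH _ vt) ->].
  by rewrite eqxx.
by rewrite orbT.
Qed.

Lemma bdry_map (f : V -> V) s : bdry (map f s) = map (map f) (bdry s).
Proof.
by elim: s => //= x t ->; congr cons; rewrite -!map_comp; exact: eq_map.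
Qed.

(** * Barycentric subdivision *)

Variable bary : seq V -> V.

(** The first argument is the size of the tuple to subdivide: the recursive calls
    are on its faces. *)
Fixpoint sd k s : seq (seq V) :=
  if k is k'.+1 then [seq bary s :: u | u <- extend (sd k') (bdry s)]
  else [:: s].

(** Subdivision is a chain map. The terms in which the barycenter is kept cancel
    because they come from the boundary of a boundary. *)
Lemma ev_sd_coboundary k s phi : size s = k ->
  ev (coboundary phi) (sd k s) = coboundary (fun u => ev phi (sd k.-1 u)) s.
Proof.
elim: k s phi => [|k IH] s phi sk.
  by case: s sk => //= _; rewrite ev_cons /coboundary !ev_nil.
rewrite /= ev_map.
rewrite (eq_ev (psi := fun u => phi u (+)
  coboundary (fun v => phi (bary s :: v)) u)) => [|u _]; last first.
  exact: coboundary_cons.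
rewrite ev_addb !ev_extend -[RHS]addbF; congr addb.
set psi := fun v => phi (bary s :: v).
rewrite -(ev_coboundary_bdry (fun w => ev psi (sd k.-1 w)) s).
by apply: eq_ev => u us; apply: IH; rewrite (size_bdry us) sk.
Qed.

(** Any property of points inherited by barycenters passes to subdivisions;
    it is used for balls, for cubes and for the faces of an octahedron. *)
Lemma sd_closed (C : V -> Prop) k s :
  (forall t, (0 < size t)%N -> {in t, forall x, C x} -> C (bary t)) ->
  size s = k -> {in s, forall x, C x} ->
  forall u, u \in sd k s -> {in u, forall x, C x}.
Proof.
move=> Cb; elim: k s => [|k IH] s sk Cs u /=.
  by rewrite inE => /eqP ->.
case/mapP => v /flatten_mapP[t ts vt] -> x; rewrite inE => /predU1P[->|].
  by apply: Cb => //; rewrite sk.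
apply: (IH t _ _ v) => //; first by rewrite (size_bdry ts) sk.
by move=> y /(bdry_sub ts); exact: Cs.
Qed.

Lemma size_sd k s u : size s = k -> u \in sd k s -> size u = k.
Proof.
elim: k s u => [|k IH] s u sk /=; first by rewrite inE => /eqP ->.
case/mapP => v /flatten_mapP[t ts vt] -> /=.
by rewrite (IH t)// (size_bdry ts) sk.
Qed.

Lemma sd_map (f : V -> V) k s :
  (forall t, bary (map f t) = f (bary t)) ->
  sd k (map f s) = map (map f) (sd k s).
Proof.
move=> fb; elim: k s => //= k IH s.
rewrite fb bdry_map /extend -!map_comp.
have -> : flatten [seq (sd k \o map f) i | i <- bdry s] =
    map (map f) (flatten [seq sd k i | i <- bdry s]).
  by rewrite map_flatten -map_comp; congr flatten; apply: eq_map => t /=.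
by rewrite -map_comp; exact: eq_map.
Qed.

End Chains.

(** * Counting sign changes *)

Section SignChanges.
Variables (V : zmodType) (eps : nat -> V -> bool).
Implicit Types (s u : seq V).

Definition antipode s := [seq - x | x <- s].

Lemma antipodeK : involutive antipode.
Proof. by move=> s; rewrite /antipode mapK//; exact: opprK. Qed.

(** A tuple x_0, ..., x_j is counted when eps k takes distinct values at
    consecutive points x_i and x_i.+1, for i + k = j - 1: this is the cup product
    of the 1-cocycles measuring the changes of the functions eps k. *)
Fixpoint sign_changes j s : bool :=
  if j isn't j'.+1 then true else
  if s is x :: t then (eps j' x (+) eps j' (head 0 t)) && sign_changes j' t
  else false.

(** The first factor of the cup product is the coboundary of eps j. *)
Let primitive j s := eps j (head 0 s) && sign_changes j s.

Lemma sign_changesS j s : size s = j.+2 ->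
  coboundary (sign_changes j) s = false /\
  sign_changes j.+1 s = coboundary (primitive j) s.
Proof.
elim: j s => [|j IH] s sz.
  case: s sz => [|x [|y []]]//= _; rewrite andbT.
  by rewrite /coboundary /= !ev_cons !ev_nil /primitive /= !andbT; case: (eps _ x); case: (eps _ y).
have cocycle : coboundary (sign_changes j.+1) s = false.
  rewrite -(ev_coboundary_bdry (primitive j) s); apply: eq_ev => u us.
  by have [] := IH u; rewrite ?(size_bdry us) ?sz.
split=> //; case: s sz cocycle => // x t [sz].
rewrite coboundary_cons => /negbT; rewrite negb_add => /eqP cocycle.
have primx : coboundary (fun u => primitive j.+1 (x :: u)) t =
    eps j.+1 x && sign_changes j.+1 t by rewrite cocycle -ev_andl.
rewrite coboundary_cons primx /primitive -[sign_changes j.+2 _]/((_ (+) _) && sign_changes j.+1 t).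
by case: (eps _ x); case: (eps _ (head 0 t)); case: sign_changes.
Qed.

Lemma sign_changes_antipode j s :
  (forall k, {in s, forall x, eps k (- x) = ~~ eps k x}) ->
  (j < size s)%N -> sign_changes j (antipode s) = sign_changes j s.
Proof.
elim: j s => [|j IH] [|x [|y s]]//= odd sj.
rewrite !odd ?inE ?eqxx ?orbT//.
rewrite -[_ :: map _ s]/(antipode (y :: s)) IH//; first by case: (eps j x); case: (eps j y).
by move=> k z zs; apply: odd; rewrite inE zs orbT.
Qed.

Lemma sign_changesP j s : sign_changes j s -> (j < size s)%N ->
  forall k, (k < j)%N -> exists x y, [/\ x \in s, y \in s & eps k x != eps k y].
Proof.
elim: j s => [|j IH] [|x [|y s]]//= /andP[xy sc] sj k.
rewrite ltnS leq_eqVlt => /predU1P[->|kj].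
  by exists x, y; rewrite !inE !eqxx orbT; move: xy; rewrite negb_eqb.
by have [z [w [zs ws zw]]] := IH _ sc sj k kj; exists z, w; rewrite inE zs inE ws !orbT.
Qed.

(** The chains H 0, ..., H n form the hemispheres of a cellular decomposition of
    the n-sphere into pairs of antipodal cells. The number of tuples of H j with
    sign changes is odd for all j: it does not change from H j to H j.+1, by
    Stokes' formula applied to the primitive of the cup product, because that
    primitive takes distinct values at a tuple of H j with sign changes and at
    its antipode. *)
Lemma odd_sign_changes n (H : nat -> seq (seq V)) :
  (forall i s, s \in H i -> size s = i.+1) ->
  ev (fun=> true) (H 0%N) ->
  (forall i phi,
     ev (coboundary phi) (H i.+1) = ev phi (H i ++ map antipode (H i))) ->
  (forall i k s, (i < n)%N -> s \in H i ->
     {in s, forall x, eps k (- x) = ~~ eps k x}) ->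
  ev (sign_changes n) (H n).
Proof.
move=> szH H0 bdH oddH; suff: forall j, (j <= n)%N -> ev (sign_changes j) (H j).
  exact.
elim=> [//|j IH] jn.
have -> : ev (sign_changes j.+1) (H j.+1) = ev (sign_changes j) (H j); last first.
  exact/IH/ltnW.
rewrite (eq_ev (psi := coboundary (primitive j))) => [|s sH]; last first.
  by have [] := @sign_changesS j s (szH _ _ sH).
rewrite bdH ev_cat ev_map -ev_addb; apply: eq_ev => s sH.
rewrite /primitive sign_changes_antipode ?(szH _ _ sH)//; last first.
  by move=> k; apply: oddH sH.
case: s sH => [/szH//|x s] sH /=; rewrite (oddH j j _ jn sH) ?inE ?eqxx//.
by case: (eps j x); case: sign_changes.
Qed.

End SignChanges.

(** * Small antipodal chains *)

Section Hemispheres.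
Variables (R : realType) (n : nat).
Notation V := 'rV[R]_n.

Definition barycenter (s : seq V) : V := (size s)%:R^-1 *: \sum_(x <- s) x.

Lemma barycenterN s : barycenter (antipode s) = - barycenter s.
Proof. by rewrite /barycenter size_map big_map sumrN scalerN. Qed.

(** The last of these vectors, axis n, is 0: the hemisphere of dimension n is
    flattened onto the ball that its boundary sphere bounds in dimension n. *)
Definition axis i : V := \row_j (i == j :> nat)%:R.

(** The hemisphere of dimension i + 1 is a cone over the sphere of dimension i,
    the union of a hemisphere and of its antipode: these are cells of the boundary
    of an octahedron. *)
Fixpoint hemisphere i : seq (seq V) :=
  if i is i'.+1 then
    [seq axis i :: u | u <- hemisphere i' ++ map (@antipode V) (hemisphere i')]
  else [:: [:: axis 0]].

Definition small_hemisphere N i :=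
  iter N (extend (sd barycenter i.+1)) (hemisphere i).

Lemma size_hemisphere i s : s \in hemisphere i -> size s = i.+1.
Proof.
elim: i s => [|i IH] s /=; first by rewrite inE => /eqP ->.
case/mapP => u; rewrite mem_cat => /orP[/IH us ->|/mapP[v /IH vs -> ->]] /=.
  by rewrite us.
by rewrite size_map vs.
Qed.

Lemma size_small_hemisphere N i s :
  s \in small_hemisphere N i -> size s = i.+1.
Proof.
elim: N s => [|N IH] s; first exact: size_hemisphere.
by case/flatten_mapP => u /IH; exact: size_sd.
Qed.

(** The chain formed by a hemisphere and its antipode is symmetric. *)
Lemma ev_antipode (phi : seq V -> bool) c :
  ev phi (c ++ map (@antipode V) c) =
  ev (fun s => phi (antipode s)) (c ++ map (@antipode V) c).
Proof.
rewrite !ev_cat !ev_map addbC; congr addb; apply: eq_ev => s _.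
by rewrite antipodeK.
Qed.

(** The boundary of a cone is its base plus the cone over the boundary of the
    base, and the base is a cycle: the two hemispheres have the same boundary. *)
Lemma hemisphere_coboundary i phi : ev (coboundary phi) (hemisphere i.+1) =
  ev phi (hemisphere i ++ map (@antipode V) (hemisphere i)).
Proof.
suff [] : ev (coboundary phi) (hemisphere i ++ map (@antipode V) (hemisphere i))
    = false /\ ev (coboundary phi) (hemisphere i.+1) =
  ev phi (hemisphere i ++ map (@antipode V) (hemisphere i)) by [].
elim: i phi => [|i IH] phi.
  rewrite /= !ev_cons !ev_nil /coboundary /= !ev_cons !ev_nil !addbF.
  by rewrite addbb; split=> //; case: (phi [:: _]); case: (phi [:: _]); case: (phi _).
have cycle psi : ev (coboundary psi)
    (hemisphere i.+1 ++ map (@antipode V) (hemisphere i.+1)) = false.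
  rewrite ev_cat (IH psi).2 [X in _ (+) X]ev_map.
  rewrite [X in _ (+) X](eq_ev
    (psi := coboundary (fun u => psi (antipode u)))) => [|s _]; last first.
    by rewrite /coboundary bdry_map ev_map.
  by rewrite (IH _).2 -ev_antipode addbb.
split=> //; rewrite [hemisphere i.+2]/= ev_map.
rewrite (eq_ev (psi := fun u => phi u (+)
    coboundary (fun v => phi (axis i.+2 :: v)) u)) => [|u _].
  by rewrite ev_addb cycle addbF.
exact: coboundary_cons.
Qed.

Lemma small_hemisphere_coboundary N i phi :
  ev (coboundary phi) (small_hemisphere N i.+1) =
  ev phi (small_hemisphere N i ++ map (@antipode V) (small_hemisphere N i)).
Proof.
elim: N phi => [|N IH] phi; first exact: hemisphere_coboundary.
rewrite ev_extend.
rewrite (eq_ev (psi := coboundary (fun u => ev phi (sd barycenter i.+1 u)))).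
  rewrite IH !ev_cat !ev_map ev_extend; congr addb.
  rewrite ev_extend; apply: eq_ev => s _.
  by rewrite (sd_map _ _ barycenterN) ev_map.
by move=> s /size_small_hemisphere; exact: ev_sd_coboundary.
Qed.

Lemma small_hemisphere0 N : small_hemisphere N 0 = [:: [:: axis 0]].
Proof.
elim: N => //= N ->; rewrite /extend /=.
by rewrite /barycenter big_seq1 invr1 scale1r.
Qed.

End Hemispheres.

(** * The Borsuk-Ulam theorem for balls *)

Section Mesh.
Variables (R : realType) (n : nat).
Notation V := 'rV[R]_n.
Implicit Types (s : seq V) (x y : V).

Definition l1 x : R := \sum_j `|x 0 j|.

Definition cube : set V := [set x | forall j, `|x 0 j| <= 1].

Definition diameter_le rho s : Prop :=
  {in s &, forall x y, forall j, `|x 0 j - y 0 j| <= rho}.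

Lemma barycenterE s j : barycenter s 0 j = (size s)%:R^-1 * \sum_(x <- s) x 0 j.
Proof. by rewrite /barycenter mxE summxE. Qed.

Lemma mean_cst s (a : R) : (0 < size s)%N ->
  (size s)%:R^-1 * (\sum_(x <- s) a) = a.
Proof.
move=> s0; rewrite big_const_seq count_predT iter_addr_0 -[a *+ _]mulr_natl.
by rewrite mulKf// pnatr_eq0 -lt0n.
Qed.

Lemma barycenter_sub s a j : (0 < size s)%N ->
  barycenter s 0 j - a = (size s)%:R^-1 * \sum_(x <- s) (x 0 j - a).
Proof. by move=> s0; rewrite barycenterE sumrB mulrBr mean_cst. Qed.

Lemma ball_barycenter p rho s : (0 < size s)%N ->
  {in s, forall x, forall j, `|x 0 j - p j| <= rho} ->
  forall j, `|barycenter s 0 j - p j| <= rho.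
Proof.
move=> s0 sp j; rewrite barycenter_sub// normrM ger0_norm ?invr_ge0//.
rewrite -[leRHS](mean_cst _ s0) ler_wpM2l ?invr_ge0//.
apply: le_trans (ler_norm_sum _ _ _) _; rewrite big_seq [leRHS]big_seq.
by apply: ler_sum => x /sp.
Qed.

(** The term of x itself vanishes in the mean of the differences, whence the
    factor smaller than 1. *)
Lemma barycenter_dist s rho x j : x \in s -> diameter_le rho s ->
  `|x 0 j - barycenter s 0 j| <= (size s).-1%:R / (size s)%:R * rho.
Proof.
move=> xs ds; have s0 : (0 < size s)%N by case: s xs {ds}.
rewrite distrC barycenter_sub// normrM ger0_norm ?invr_ge0//.
rewrite mulrAC mulrC ler_wpM2r ?invr_ge0//.
apply: le_trans (ler_norm_sum _ _ _) _.
rewrite (big_rem x)//= subrr normr0 add0r.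
apply: (@le_trans _ _ (\sum_(y <- rem x s) rho)).
  by rewrite big_seq [leRHS]big_seq; apply: ler_sum => y /mem_rem ys; exact: ds.
by rewrite big_const_seq count_predT iter_addr_0 size_rem// mulr_natl.
Qed.

(** Two vertices of a simplex of the subdivision are either on a smaller face, or
    one of them is the barycenter, and then the whole simplex lies in a ball
    around it. *)
Lemma sd_diameter theta rho k s : 0 <= rho -> 0 <= theta ->
  (forall i, (0 < i <= k)%N -> i.-1%:R / i%:R <= theta) ->
  size s = k -> diameter_le rho s ->
  forall u, u \in sd (@barycenter R n) k s -> (0 < k)%N ->
  diameter_le (theta * rho) u.
Proof.
move=> rho0 theta0; elim: k s => [//|k IH] s thetaP sk ds u + _ /=.
case/mapP => v /flatten_mapP[t ts vt] ->.
have near_bary x : x \in v -> forall j,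
    `|x 0 j - barycenter s 0 j| <= theta * rho.
  apply: (sd_closed (C := fun x => forall j, _ <= theta * rho) _ _ _ vt).
  - by move=> w w0 wC j; exact: (ball_barycenter (p := fun j => barycenter s 0 j)).
  - by rewrite (size_bdry ts) sk.
  - move=> y /(bdry_sub ts) ys j; apply: le_trans (barycenter_dist _ ys ds) _.
    by rewrite ler_wpM2r// sk thetaP//= leqnn.
have dv : diameter_le (theta * rho) v.
  have tk : size t = k by rewrite (size_bdry ts) sk.
  case: (posnP k) => [k0|k0].
    have := size_sd tk vt; rewrite k0 => /size0nil -> x y; by rewrite in_nil.
  apply: IH vt _ => //.
    by move=> i /andP[i0 ik]; rewrite thetaP// i0 leqW.
  by move=> x y /(bdry_sub ts) xs /(bdry_sub ts) ys; exact: ds.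
move=> x y; rewrite !inE => /predU1P[->|xv] /predU1P[->|yv] j.
- by rewrite subrr normr0 mulr_ge0.
- by rewrite distrC; exact: near_bary.
- exact: near_bary.
- exact: dv.
Qed.

Lemma hemisphere_cube i s : s \in hemisphere R n i -> {in s, forall x, cube x}.
Proof.
have axis_cube k : cube (axis R n k).
  by move=> j; rewrite mxE; case: (_ == _); rewrite ?normr1 ?normr0.
elim: i s => [|i IH] s /=.
  by rewrite inE => /eqP-> x; rewrite inE => /eqP->.
case/mapP => u; rewrite mem_cat => /orP[us|/mapP[v vs ->]] -> x;
    rewrite inE => /predU1P[->|]//; first exact: IH us x.
by case/mapP => y yv -> j; rewrite mxE normrN; exact: IH vs y yv j.
Qed.

Lemma small_hemisphere_cube N i s :
  s \in small_hemisphere R n N i -> {in s, forall x, cube x}.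
Proof.
elim: N s => [|N IH] s; first exact: hemisphere_cube.
case/flatten_mapP => u uN; apply: sd_closed; last exact: IH uN.
  move=> t t0 tC j; rewrite -[X in `|X|]subr0.
  by apply: (ball_barycenter (p := fun=> 0)) => // x /tC xC k; rewrite subr0.
exact: size_small_hemisphere uN.
Qed.

(** A simplex of the boundary sphere lies in a face of the octahedron: the set
    of points whose coordinates have given signs and l1 norm 1. *)
Definition face (t : 'I_n -> R) : set V :=
  [set x | \sum_j t j * x 0 j = 1 /\ forall j, 0 <= t j * x 0 j].

Lemma hemisphere_face i s : (i < n)%N -> s \in hemisphere R n i ->
  exists t, (forall j, `|t j| = 1) /\
    {in s, forall x, face t x /\ forall j : 'I_n, (i < j)%N -> x 0 j = 0}.
Proof.
have axisE k t : (k < n)%N -> (forall j : 'I_n, j = k :> nat -> t j = 1) ->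
    face t (axis R n k).
  move=> kn tk; split.
    rewrite (bigD1 (Ordinal kn))//= mxE eqxx mulr1 tk// big1 ?addr0// => j.
    by rewrite -val_eqE eq_sym mxE /= => /negbTE ->; rewrite mulr0.
  by move=> j; rewrite mxE; case: eqP => [kj|]; rewrite ?mulr0// tk ?mulr1.
elim: i s => [|i IH] s /= iN.
  rewrite inE => /eqP ->; exists (fun=> 1); split; first by move=> j; rewrite normr1.
  move=> x; rewrite inE => /eqP ->; split; first exact: axisE.
  by move=> j j0; rewrite mxE; case: eqP j0 => // <-.
have step (u : seq V) : (exists t, (forall j, `|t j| = 1) /\
    {in u, forall x, face t x /\ forall j : 'I_n, (i < j)%N -> x 0 j = 0}) ->
    exists t, (forall j, `|t j| = 1) /\ {in axis R n i.+1 :: u, forall x,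
      face t x /\ forall j : 'I_n, (i.+1 < j)%N -> x 0 j = 0}.
  move=> [t [t1 tu]]; exists (fun j : 'I_n => if j == i.+1 :> nat then 1 else t j).
  split; first by move=> j; case: ifP => // _; rewrite normr1.
  move=> x; rewrite inE => /predU1P[->|/tu[[tx1 tx0] x0]].
    split; first by apply: axisE => // j ->; rewrite eqxx.
    by move=> j; rewrite mxE; case: ltngtP.
  split; last by move=> j /ltnW; exact: x0.
  have tE (j : 'I_n) : (if j == i.+1 :> nat then 1 else t j) * x 0 j = t j * x 0 j.
    by case: eqP => // ji; rewrite x0 ?ji// !mulr0.
  by split; [rewrite (eq_bigr _ (fun j _ => tE j))|move=> j; rewrite tE].
case/mapP => u; rewrite mem_cat => /orP[us|/mapP[v vs ->]] ->; apply: step.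
  exact: IH (ltnW iN) us.
have [t [t1 tv]] := IH _ (ltnW iN) vs; exists (fun j => - t j).
split; first by move=> j; rewrite normrN.
move=> _ /mapP[x /tv[[tx1 tx0] x0] ->]; split.
  split; last by move=> j; rewrite mxE mulrNN.
  by under eq_bigr do rewrite mxE mulrNN.
by move=> j /x0 x0j; rewrite mxE x0j oppr0.
Qed.

Lemma face_barycenter t s : (0 < size s)%N -> {in s, forall x, face t x} ->
  face t (barycenter s).
Proof.
move=> s0 sF; split=> [|j]; last first.
  rewrite barycenterE mulrCA mulr_ge0 ?invr_ge0// mulr_sumr big_seq sumr_ge0//.
  by move=> x /sF[].
under eq_bigr do rewrite barycenterE mulrCA mulr_sumr.
rewrite -mulr_sumr exchange_big /= -[RHS](mean_cst _ s0); congr (_ * _).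
by rewrite big_seq [RHS]big_seq; apply: eq_bigr => x /sF[].
Qed.

Lemma small_hemisphere_sphere N i s : (i < n)%N ->
  s \in small_hemisphere R n N i -> {in s, forall x, l1 x = 1}.
Proof.
move=> iN sN; suff [t [t1 ts]] : exists t, (forall j, `|t j| = 1) /\
    {in s, forall x, face t x}.
  move=> x /ts[<- tx]; apply: eq_bigr => j _.
  by rewrite -[RHS]ger0_norm// normrM t1 mul1r.
elim: N s sN => [|N IH] s.
  by move=> /(hemisphere_face iN)[t [t1 ts]]; exists t; split=> // x /ts[].
case/flatten_mapP => u /[dup] uN /IH[t [t1 tu]] su; exists t; split=> //.
apply: sd_closed su => //; last exact: size_small_hemisphere uN.
exact: face_barycenter.
Qed.

Lemma small_hemisphere_mesh (d : R) i : 0 < d -> exists N,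
  forall s, s \in small_hemisphere R n N i -> diameter_le d s.
Proof.
move=> d0; pose theta : R := i%:R / i.+1%:R.
have theta0 : 0 <= theta by rewrite divr_ge0.
have theta1 : theta < 1 by rewrite ltr_pdivrMr// mul1r ltr_nat.
have thetaP k : (0 < k <= i.+1)%N -> k.-1%:R / k%:R <= theta.
  case: k => // k /=; rewrite ltnS => ki.
  rewrite ler_pdivrMr ?ltr0n// mulrAC ler_pdivlMr ?ltr0n// -!natrM ler_nat.
  by rewrite !mulnS [(i * k)%N]mulnC leq_add2r.
have mesh N s : s \in small_hemisphere R n N i -> diameter_le (theta ^+ N * 2) s.
  elim: N s => [|N IH] s.
    move=> /hemisphere_cube sC x y /sC xC /sC yC j; rewrite expr0 mul1r.
    by rewrite (le_trans (ler_normB _ _))// -[2]/(1 + 1) lerD// ?xC ?yC.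
  case/flatten_mapP => u uN su; rewrite exprS -mulrA.
  apply: sd_diameter su _ => //; [|exact: size_small_hemisphere uN|exact: IH].
  by rewrite mulr_ge0// exprn_ge0.
have [N thetaN] : exists N, theta ^+ N * 2 <= d.
  have : `|theta| < 1 by rewrite ger0_norm.
  move=> /(@cvg_geometric R 2 theta)/cvgrPdist_lt/(_ _ d0)[N _ /(_ N (leqnn N))] /=.
  rewrite sub0r normrN mulrC => /ltW Nd; exists N.
  exact: le_trans (ler_norm _) Nd.
exists N => s /mesh sN x y xs ys j; exact: le_trans (sN _ _ xs ys j) thetaN.
Qed.

End Mesh.

Arguments cube {R n}.

Section BorsukUlam.
Variables (R : realType) (n : nat).
Notation V := 'rV[R]_n.

Lemma compact_cube : compact (@cube R n).
Proof.
have -> : @cube R n = [set v : V | forall i, `[(-1 : R), 1]%classic (v ord0 i)].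
  by apply/seteqP; split=> x /= xC j; have := xC j; rewrite in_itv /= ler_norml.
by apply: (rV_compact (fun=> @segment_compact _ _ _)).
Qed.

(** Uniform continuity on the cube; the second point may be outside of it. *)
Lemma cube_heine (g : V -> R) (e : R) : continuous g -> 0 < e ->
  \forall d \near (0 : R)^'+, forall x z : V, cube x ->
    (forall j, `|x 0 j - z 0 j| < d) -> `|g x - g z| < e.
Proof.
move=> cg e0.
have : \forall d \near (0 : R)^'+, cube `<=` (fun x => forall z : V,
    (forall j, `|x 0 j - z 0 j| < d) -> `|g x - g z| < e).
  apply: (compact_near_coveringP _).1; first exact: compact_cube.
  move=> x _; have e2 : 0 < e / 2 by rewrite divr_gt0.
  have /cvgrPdist_lt/(_ _ e2)/nbhs_ballP[r /= r0 rg] := cg x.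
  have r2 : 0 < r / 2 by rewrite divr_gt0.
  exists (ball x (r / 2), [set d | d < r / 2]).
    by split; [exact: nbhsx_ballx|exact: nbhs_right_lt].
  move=> [y d] /= [[_ xy] dr] z yz.
  have xz : ball x r z.
    split=> // i j; rewrite [r]splitr.
    apply: ball_triangle (xy i j) _; rewrite /ball /= (ord1 i).
    exact: lt_trans (yz j) dr.
  have xy' : ball x r y.
    by split=> // i j; apply: le_ball (xy i j); lra.
  have := rg _ xz; have := rg _ xy'; rewrite /= distrC => gy gz.
  rewrite -(subrKA (g x)) (le_lt_trans (ler_normD _ _))//.
  by rewrite [e]splitr ltrD.
by apply: filterS => d dP x z xC; exact: dP.
Qed.

(** Any choice of one point in each antipodal pair gives a way to decide the
    sign of a real number attached to a point when that number is 0. *)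
Let selected (x : V) : bool := choose (pred2 x (- x)) x == x.

Let selectedN x : x != - x -> selected (- x) = ~~ selected x.
Proof.
move=> xN; rewrite /selected.
have -> : choose (pred2 (- x) (- - x)) (- x) = choose (pred2 x (- x)) x.
  rewrite (@eq_choose _ _ (pred2 x (- x))) => [|z]; last first.
    by rewrite /= opprK orbC.
  by apply: choose_id; rewrite /= eqxx ?orbT.
have : pred2 x (- x) (choose (pred2 x (- x)) x).
  by apply: (chooseP (P := pred2 x (- x))); rewrite /= eqxx.
by rewrite /= => /orP[]/eqP ->; rewrite eqxx ?(negbTE xN)// eq_sym (negbTE xN).
Qed.

Lemma l1_neqN (x : V) : l1 x = 1 -> x != - x.
Proof.
move=> x1; apply/negP => /eqP xN; have l10 : l1 x = 0.
  rewrite /l1; apply: big1 => j _; apply/eqP; rewrite normr_eq0; apply/eqP.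
  have : x 0 j = - x 0 j by rewrite {1}xN mxE.
  by lra.
by move: l10; rewrite x1 => /eqP; rewrite oner_eq0.
Qed.

(** If there were no zero, the sum of the absolute values of the coordinates
    would have a positive minimum on the cube. This is impossible at a small
    simplex along which every coordinate changes sign. *)
Theorem borsuk_ulam_ball (y : 'I_n -> V -> R) :
  (forall k, continuous (y k)) ->
  (forall x, l1 x = 1 -> forall k, y k (- x) = - y k x) ->
  exists2 x, cube x & forall k, y k x = 0.
Proof.
move=> cy odd_y; apply: contrapT => no_zero.
pose F x := \sum_k `|y k x|.
have cF : continuous F.
  by apply: cont_sum => k _; exact: cont_norm.
have [c /set_mem cC Fmin] : exists2 c, c \in @cube R n &
    forall t, t \in @cube R n -> F c <= F t.
  apply: EVT_min_rV; [|exact: compact_cube|exact: continuous_subspaceT].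
  by exists 0 => j; rewrite mxE normr0.
have Fc : 0 < F c.
  rewrite lt_neqAle sumr_ge0// andbT eq_sym; apply/negP => /eqP Fc0.
  apply: no_zero; exists c => // k; apply/normr0_eq0.
  by apply: (psumr_eq0P _ Fc0) => // i _.
pose delta := F c / (2 * n.+1%:R).
have delta0 : 0 < delta by rewrite divr_gt0// mulr_gt0.
have [d d0 dP] : exists2 d, 0 < d & forall k (x z : V), cube x ->
    (forall j, `|x 0 j - z 0 j| < d) -> `|y k x - y k z| < delta.
  have close_d : \forall d \near (0 : R)^'+, forall k (x z : V), cube x ->
      (forall j, `|x 0 j - z 0 j| < d) -> `|y k x - y k z| < delta.
    by apply: filter_forall => k; exact: cube_heine.
  by have [d [d0 dP]] := filter_ex (filterI (nbhs_right_gt (0 : R)) close_d); exists d.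
have d2 : 0 < d / 2 by rewrite divr_gt0.
have [N mesh] := small_hemisphere_mesh n n d2.
(* For k >= n, where there is no coordinate, any odd function will do. *)
pose eps k x : bool := if insub k is Some i
  then (0 < y i x) || (y i x == 0) && selected x else selected x.
have [s sN sc] : exists2 s, s \in small_hemisphere R n N n & sign_changes eps n s.
  apply: ev_true.
  apply: (odd_sign_changes (H := small_hemisphere R n N)).
  - exact: size_small_hemisphere.
  - by rewrite small_hemisphere0 ev_cons ev_nil.
  - exact: small_hemisphere_coboundary.
  - move=> i k s iN sN x xs; have x1 := small_hemisphere_sphere iN sN xs.
    have xN : x != - x by exact: l1_neqN.
    rewrite /eps; case: insubP => [k' _ _|_]; last exact: selectedN.
    rewrite odd_y// oppr_gt0 oppr_eq0 selectedN//.
    by case: ltgtP => //= _; case: selected.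
have ssz := size_small_hemisphere sN.
have sC := small_hemisphere_cube sN.
have close x z k : x \in s -> z \in s -> `|y k x - y k z| < delta.
  move=> xs zs; apply: dP => [|j]; first exact: sC.
  by rewrite (le_lt_trans (mesh _ sN _ _ xs zs j))// ltr_pdivrMr//; lra.
have small x k : x \in s -> `|y k x| <= delta + delta.
  move=> xs.
  have [z [w [zs ws]]] : exists z w, [/\ z \in s, w \in s & eps k z != eps k w].
    by apply: sign_changesP sc _ _ _; rewrite ?ssz.
  rewrite /eps valK => zw.
  have : `|y k z| <= `|y k z - y k w|.
    move: zw; case: (ltgtP (y k z) 0) => [z0|z0|->]; last by rewrite normr0.
      case: (ltgtP (y k w) 0) => //= [w0|->] _; last by rewrite subr0.
      by rewrite ltr0_norm// ltr0_norm; lra.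
    case: (ltgtP (y k w) 0) => //= [w0|->] _; last by rewrite subr0.
    by rewrite gtr0_norm// gtr0_norm; lra.
  have := close _ _ k zs ws; have := close _ _ k xs zs.
  have := ler_normD (y k x - y k z) (y k z); rewrite subrK; lra.
case: s ssz {sN sc} sC close small => // x s _ sC _ small.
have xs : x \in x :: s by rewrite inE eqxx.
have : F x <= \sum_(k < n) (delta + delta) by apply: ler_sum => k _; exact: small.
have : F c <= F x by apply: Fmin; rewrite inE; exact: sC.
rewrite sumr_const card_ord -[(_ + _) *+ _]mulr_natr => /le_trans le /le.
apply/negP; rewrite -ltNge /delta -[X in _ < X]mulr1.
have -> : (F c / (2 * n.+1%:R) + F c / (2 * n.+1%:R)) * n%:R =
    F c * (n%:R / n.+1%:R).
  have : n.+1%:R != 0 :> R by rewrite pnatr_eq0.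
  by move: (n.+1%:R) => m m0; field.
by rewrite ltr_pM2l// ltr_pdivrMr ?ltr0n// mul1r ltr_nat.
Qed.

End BorsukUlam.

(** * Balls and hemispheres *)

Lemma continuous_sub (X : topologicalType) (T : z2space) (A : set T)
    (AP : forall x, A x -> A (z2inv x)) (f : X -> sub_z2space AP) :
  continuous (fun x => set_val (f x) : T) -> continuous f.
Proof. exact: continuous_comp_initial. Qed.

Lemma continuous_set_val (T : z2space) (A : set T)
    (AP : forall x, A x -> A (z2inv x)) :
  continuous (fun x : sub_z2space AP => set_val x : T).
Proof. exact: initial_continuous. Qed.

Lemma cont_l1 (R : realType) n : continuous (@l1 R n).
Proof. by apply: cont_sum => j _; apply/cont_norm/coord_continuous. Qed.

Section BallToSphere.
Variables (R : realType) (n d : nat) (nd : (n <= d)%N).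

Let lift_coord (j : 'I_d.+1) (x : 'rV[R]_n) : R :=
  if insub (j : nat) is Some i then x 0 i
  else if j == n :> nat then 1 - l1 x else 0.

Let norm2 x := Num.sqrt (\sum_j lift_coord j x ^+ 2).

Let norm2_gt0 x : 0 < norm2 x.
Proof.
rewrite sqrtr_gt0 lt_neqAle eq_sym sumr_ge0 ?andbT => [|j _]; last exact: sqr_ge0.
apply/negP => /eqP /psumr_eq0P x0.
have {}x0 j : lift_coord j x = 0.
  by apply/eqP; rewrite -sqrf_eq0; apply/eqP; apply: x0 => // i _; exact: sqr_ge0.
have := x0 (inord n); rewrite /lift_coord inordK// insubN ?ltnn// eqxx.
rewrite /l1 big1 ?subr0 => [/eqP|i _]; first by rewrite oner_eq0.
have := x0 (widen_ord (leqW nd) i); rewrite /lift_coord /= valK => ->.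
exact: normr0.
Qed.

Let cont_lift_coord j : continuous (lift_coord j).
Proof.
rewrite /lift_coord; case: insubP => [i _ _|_]; first exact: coord_continuous.
case: eqP => _; last exact: cont_cst.
by apply: cont_sub; [exact: cont_cst|exact: cont_l1].
Qed.

Let lifted x : 'rV[R]_d.+1 := \row_j (lift_coord j x / norm2 x).

Let lifted_sphere x : sphere_set (lifted x : euclidean_z2space R d).
Proof.
rewrite /sphere_set /=; under eq_bigr do rewrite mxE expr_div_n.
rewrite -mulr_suml sqr_sqrtr; last by apply: sumr_ge0 => j _; exact: sqr_ge0.
by rewrite divff//; have := norm2_gt0 x; rewrite sqrtr_gt0 => /gt_eqF ->.
Qed.

(** The graph of 1 - l1 over the unit ball of the l1 norm, projected to the
    sphere, is a hemisphere. *)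
Lemma ball_to_sphere : exists P : 'rV[R]_n -> sphere R d,
  continuous P /\ forall x, l1 x = 1 -> P (- x) = z2inv (P x).
Proof.
exists (fun x => SigSub (mem_set (lifted_sphere x))); split.
  apply: continuous_sub; apply: (@cont_row _ _ _ (fun j x => lift_coord j x / norm2 x)).
  move=> j; apply: cont_mul; first exact: cont_lift_coord.
  apply: cont_inv => [|x]; last by rewrite gt_eqF.
  apply: cont_sqrt; apply: cont_sum => i _.
  exact/cont_exp/cont_lift_coord.
move=> x x1; apply: val_inj => /=.
have liftN j : lift_coord j (- x) = - lift_coord j x.
  rewrite /lift_coord; case: insubP => [i _ _|_]; first by rewrite mxE.
  case: eqP => _; last by rewrite oppr0.
  have -> : l1 (- x) = l1 x by apply: eq_bigr => i _; rewrite mxE normrN.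
  by rewrite x1 subrr oppr0.
apply/rowP => j; rewrite !mxE liftN mulNr; congr (- (_ / Num.sqrt _)).
by apply: eq_bigr => i _; rewrite liftN sqrrN.
Qed.

End BallToSphere.

(** A supremum of natural numbers is at least n only if one of them is. *)
Lemma coind_ge (R : realType) (T : z2space) n :
  (n%:R%:E <= coind R T)%E ->
  exists2 d, (n <= d)%N & exists f : sphere R d -> T, is_z2map f.
Proof.
move=> nT; apply: contrapT => no_map.
case: n nT no_map => [|n] nT no_map.
  apply: no_map; apply: contrapT => no_map; move: nT.
  rewrite /coind (_ : [set _ | _ in _] = set0) ?ereal_sup0//.
  by rewrite -subset0 => _ /= [d [f fT] _]; apply: no_map; exists d => //; exists f.
move: nT; apply/negP; rewrite -ltNge; apply: (@le_lt_trans _ _ n%:R%:E).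
  apply: ge_ereal_sup => _ /= [d [f fT] <-]; rewrite lee_fin ler_nat leqNgt.
  by apply/negP => nd; apply: no_map; exists d => //; exists f.
by rewrite lte_fin ltr_nat.
Qed.

Lemma ge_coind (R : realType) (T : z2space) d (f : sphere R d -> T) :
  is_z2map f -> (d%:R%:E <= coind R T)%E.
Proof. by move=> fT; apply: ereal_sup_ubound; exists d => //; exists f. Qed.

(** An equivariant map out of a sphere, restricted to a hemisphere flattened onto
    a ball, becomes a map from a contractible space that is equivariant on the
    boundary only. *)
Lemma coind_ball (R : realType) (T : z2space) n : (n%:R%:E <= coind R T)%E ->
  exists f : 'rV[R]_n -> T,
    continuous f /\ forall x, l1 x = 1 -> f (- x) = z2inv (f x).
Proof.
move=> /coind_ge[d nd [f [cf fN]]]; have [P [cP PN]] := ball_to_sphere R nd.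
exists (f \o P); split=> [x|x x1 /=]; last by rewrite PN.
by apply: continuous_comp; [exact: cP|exact: cf].
Qed.

(** * Points of the box complex and colorings *)

Section BoxPoints.
Variables (R : realType) (G : sgraph).
Implicit Types p : box_space G R.

Lemma uplusE (S T : {set G}) v b :
  ((v, b) \in uplus S T) = if b then v \in T else v \in S.
Proof. by rewrite !inE /=; case: b; rewrite ?andbT ?andbF ?orbF. Qed.

Lemma barycoordP p : [/\ forall x, 0 <= barycoord p x,
  \sum_x barycoord p x = 1 &
  forall u v, 0 < barycoord p (u, false) -> 0 < barycoord p (v, true) ->
    adj u v].
Proof.
have [X XB []] : realization_set (box_complex G)
    (barycoord p : {ptws G * bool -> R}) by exact: set_valP p.
move: (barycoord p) => a a0 aN a1.
have supp x : 0 < a x -> x \in X by apply: contraPT => /aN ->; rewrite ltxx.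
split=> [x||u v /supp uX /supp vX].
- by case: (boolP (x \in X)) => [/a0//|/aN ->].
- rewrite -[RHS]a1 [RHS]big_mkcond; apply: eq_bigr => x _ /=.
  by case: ifPn => // /aN.
- move: XB uX vX; rewrite inE => /existsP[S /existsP[T /and3P[/eqP-> _ ST]]].
  by rewrite !uplusE => uS vT; exact: (forall_inP (forall_inP ST u uS)).
Qed.

Lemma barycoordN p x : barycoord (z2inv p) x = barycoord p (swap x).
Proof. by []. Qed.

Lemma cont_barycoord x : continuous (fun p => barycoord p x).
Proof.
have cv : continuous (fun p => set_val p : {ptws G * bool -> R}).
  exact: initial_continuous.
move=> p; apply: (@continuous_comp _ _ _
  (fun p => set_val p : {ptws G * bool -> R}) (fun a => a x)); first exact: cv.
exact: (@proj_continuous _ (fun=> R) x).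
Qed.

(** This odd function of p is what a coloring of G turns into a signed measure on
    the colors. *)
Definition signed_weight p v : R := barycoord p (v, false) - barycoord p (v, true).

Lemma signed_weightN p v : signed_weight (z2inv p) v = - signed_weight p v.
Proof. by rewrite /signed_weight !barycoordN opprB. Qed.

Lemma cont_signed_weight v : continuous (fun p => signed_weight p v).
Proof. by apply: cont_sub; exact: cont_barycoord. Qed.

Lemma sum_barycoord p : \sum_x barycoord p x =
  \sum_v barycoord p (v, false) + \sum_v barycoord p (v, true).
Proof.
rewrite -big_split /= (eq_bigr (fun v => \sum_(b : bool) barycoord p (v, b))).
  by rewrite pair_big /=; apply: eq_bigr => -[].
by move=> v _; rewrite big_bool /= addrC.
Qed.

End BoxPoints.

(** The moments of orders 0, ..., 2r - 2 of the signed measure that a point of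
    the box complex puts on the colors vanish simultaneously somewhere, by
    Borsuk-Ulam. Integrating against this measure the square of a polynomial
    whose roots are the colors around a vertex u of positive weight, fewer than r
    in number, gives a contradiction: the polynomial kills the negative part of
    the measure, but not the color of u. *)
Lemma topologically_chromatic_nbr_colors (R : realType) (r : nat) (G : sgraph)
    (c : G -> nat) : (0 < r)%N ->
  topologically_chromatic R (2 * r) G -> proper_coloring c ->
  exists v, (r <= nbr_colors c v)%N.
Proof.
move=> r0 topG cP; apply: contrapT => few.
have {}few v : (nbr_colors c v < r)%N by rewrite ltnNge; apply/negP => ?; apply: few; exists v.
have [f [cf fN]] : exists f : 'rV[R]_(2 * r).-1 -> box_space G R,
    continuous f /\ forall x, l1 x = 1 -> f (- x) = z2inv (f x).
  apply: coind_ball; rewrite (_ : _%:R = (2 * r)%:R - 1)//.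
  by rewrite -subn1 natrB ?muln_gt0.
pose moment (k : 'I_(2 * r).-1) x : R :=
  \sum_v signed_weight (f x) v * (c v)%:R ^+ k.
have [x _ moment0] : exists2 x, cube x & forall k, moment k x = 0.
  apply: borsuk_ulam_ball => [k|x x1 k].
    apply: cont_sum => v _; apply: cont_mul; last exact: cont_cst.
    move=> x; apply: (@continuous_comp _ _ _ f (fun p => signed_weight p v)).
      exact: cf.
    exact: cont_signed_weight.
  rewrite /moment fN// -sumrN; apply: eq_bigr => v _.
  by rewrite signed_weightN mulNr.
have integral0 (p : {poly R}) : (size p <= (2 * r).-1)%N ->
    \sum_v barycoord (f x) (v, false) * p.[(c v)%:R] =
    \sum_v barycoord (f x) (v, true) * p.[(c v)%:R].
  move=> sp; apply/eqP; rewrite -subr_eq0 -sumrB; apply/eqP.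
  transitivity (\sum_(k < (2 * r).-1) p`_k * moment k x).
    under eq_bigr => v _ do
      rewrite -mulrBl -/(signed_weight (f x) v) (horner_coef_wide _ sp) mulr_sumr.
    rewrite exchange_big /=; apply: eq_bigr => k _; rewrite mulr_sumr.
    by apply: eq_bigr => v _; rewrite mulrCA.
  by rewrite big1// => k _; rewrite moment0 mulr0.
have [a0 a1 aE] := barycoordP (f x).
have [u u0] : exists u, 0 < barycoord (f x) (u, false).
  apply: contrapT => /forallNP nou.
  have z0 v : barycoord (f x) (v, false) = 0.
    by apply/eqP; rewrite eq_le a0 andbT leNgt; apply/negP.
  have /integral0 : (size (1%R : {poly R}) <= (2 * r).-1)%N.
    by rewrite size_poly1 mul2n -(prednK r0) doubleS.
  under eq_bigr do rewrite z0 mul0r.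
  under [RHS]eq_bigr do rewrite hornerC mulr1.
  rewrite big1// => s0; move: a1; rewrite sum_barycoord -s0 big1// addr0.
  by move/eqP; rewrite eq_sym oner_eq0.
pose nbrs := undup [seq c w | w <- enum G & adj u w].
have nbrsP w : adj u w -> c w \in nbrs.
  by move=> uw; rewrite mem_undup map_f// mem_filter uw mem_enum.
pose q : {poly R} := \prod_(g <- nbrs) ('X - g%:R%:P).
have q0 a : root q a%:R = (a \in nbrs).
  rewrite /q -(big_map (fun g : nat => g%:R : R) xpredT (fun z => 'X - z%:P)).
  by rewrite root_prod_XsubC mem_map// => i j /eqP; rewrite eqr_nat => /eqP.
have sq : (size (q ^+ 2) <= (2 * r).-1)%N.
  have qE : q = \prod_(z <- [seq g%:R | g <- nbrs]) ('X - z%:P) by rewrite big_map.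
  have sizeq : size q = (size nbrs).+1 by rewrite qE size_prod_XsubC size_map.
  have q_neq0 : q != 0 by rewrite -size_poly_gt0 sizeq.
  rewrite expr2 size_mul// sizeq addSn addnS /= addnn.
  have := few u; rewrite /nbr_colors -/nbrs -[X in (_ < X)%N](prednK r0) ltnS => le_r.
  by rewrite mul2n -(prednK r0) doubleS /= ltnS leq_double.
have := integral0 _ sq; rewrite [RHS]big1 => [|v _]; last first.
  have [v0|v0] := ltP 0 (barycoord (f x) (v, true)); last first.
    by rewrite (le_anti (introT andP (conj v0 (a0 _)))) mul0r.
  by have := nbrsP _ (aE _ _ u0 v0); rewrite -q0 horner_exp => /eqP ->; rewrite expr0n mulr0.
move/psumr_eq0P => u_eq0.
have : barycoord (f x) (u, false) * (q ^+ 2).[(c u)%:R] = 0.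
  by apply: u_eq0 => // v _; rewrite mulr_ge0// horner_exp sqr_ge0.
move=> /eqP; rewrite mulf_eq0 gt_eqF//= horner_exp sqrf_eq0 -rootE q0 mem_undup.
by case/mapP => w; rewrite mem_filter => /andP[/cP uw _] /uw.
Qed.

(** * Graphs built from self-dual families of sets *)

Section SelfDual.
Variables (d : nat) (losing : pred {set 'I_d.+2}).
Notation I := 'I_d.+2.
Hypothesis losingS : forall A B : {set I}, A \subset B -> losing B -> losing A.
Hypothesis losingC : forall A : {set I}, losing (~: A)%SET = ~~ losing A.

Definition selfdual_adj : rel (I * {set I}) := fun v w =>
  [&& v.1 \in w.2, w.1 \in v.2, v.1 \notin v.2, w.1 \notin w.2,
      losing v.2 & losing w.2].

Lemma selfdual_adj_sym : symmetric selfdual_adj.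
Proof.
move=> v w; rewrite /selfdual_adj.
by apply/idP/idP => /and5P[-> -> -> -> /andP[-> ->]].
Qed.

Lemma selfdual_adj_irr : irreflexive selfdual_adj.
Proof. by move=> v; rewrite /selfdual_adj; case: (v.1 \in v.2). Qed.

Definition selfdual_graph := SGraph selfdual_adj_sym selfdual_adj_irr.

Variable R : realType.
Implicit Types (x u : I -> R) (y z : I * {set I} * bool).

Lemma losing0 : losing finset.set0.
Proof.
case: (boolP (losing finset.set0)) => // n0.
have nC : losing (~: finset.set0)%SET by rewrite losingC.
by rewrite -(negbTE n0); exact: losingS (finset.sub0set _) nC.
Qed.

(** A pivot generalizes the median, obtained when the losing sets are those with
    less than half of the elements. *)
Definition is_pivot x (h : R) : Prop :=
  losing [set i | h < x i]%SET /\ losing [set i | x i < h]%SET.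

(** The least value h of x such that the set where x > h is losing is a pivot: if
    the set where x < h were not losing, the next smaller value would also do. *)
Lemma exists_pivot x : exists h, is_pivot x h.
Proof.
have max_spec := @Order.TotalTheory.arg_maxP _ R.
have min_spec := @Order.TotalTheory.arg_minP _ R.
pose P i := losing [set j | x i < x j]%SET.
have [i0 Pi0] : exists i0, P i0.
  case: (max_spec _ ord0 xpredT x isT) => i0 _ i0max; exists i0.
  apply: losingS losing0; apply/fintype.subsetP => j; rewrite !inE ltNge.
  by rewrite (i0max j isT : x j <= x i0).
case: (min_spec _ _ P x Pi0) => i Pi imin; exists (x i); split=> //.
apply: contrapT => /negP nL; have [j0 ji0] : exists j, x j < x i.
  apply: contrapT => /forallNP nj; apply: (negP nL).
  apply: losingS losing0; apply/fintype.subsetP => j; rewrite !inE => ji.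
  by have := nj j.
case: (max_spec _ _ (fun j => x j < x i) x ji0) => j ji jmax.
have /imin : P j.
  move: nL; rewrite -losingC; apply: losingS; apply/fintype.subsetP => k.
  rewrite !inE -leNgt => jk; rewrite leNgt; apply/negP => /jmax.
  by rewrite /= leNgt jk.
by rewrite /= leNgt ji.
Qed.

(** Otherwise the losing sets where x > h and where x' < h' would cover all
    indices, and one of two complementary sets is not losing. *)
Lemma pivot_le x x' h h' (e : R) : is_pivot x h -> is_pivot x' h' ->
  (forall i, `|x i - x' i| <= e) -> h' <= h + e.
Proof.
move=> [xh _] [_ xh'] xx'; rewrite leNgt; apply/negP => hh'.
move: xh'; apply/negP; rewrite -losingC; apply: losingS xh.
apply/fintype.subsetP => i; rewrite !inE -leNgt => ih'.
by have := xx' i; rewrite ler_norml => /andP[]; lra.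
Qed.

Definition pivot x : R := xget 0 (is_pivot x).

Lemma pivotP x : is_pivot x (pivot x).
Proof. by have [h xh] := exists_pivot x; exact: (xgetPex 0 (ex_intro _ h xh)). Qed.

Lemma is_pivot_unique x h : is_pivot x h -> pivot x = h.
Proof.
move=> xh; have x0 i : `|x i - x i| <= 0 by rewrite subrr normr0.
by apply/eqP; rewrite eq_le -{1}[h]addr0 -{2}[pivot x]addr0;
  rewrite (pivot_le xh (pivotP x) x0) (pivot_le (pivotP x) xh x0).
Qed.

Lemma pivotN x : pivot (fun i => - x i) = - pivot x.
Proof.
apply: is_pivot_unique; have [xg xl] := pivotP x; split.
  by rewrite (_ : finset _ = [set i | x i < pivot x]%SET)//;
    apply/setP => i; rewrite !inE ltrN2.
by rewrite (_ : finset _ = [set i | pivot x < x i]%SET)//;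
  apply/setP => i; rewrite !inE ltrN2.
Qed.

Lemma cont_pivot (T : topologicalType) (X : I -> T -> R) :
  (forall i, continuous (X i)) -> continuous (fun t => pivot (X^~ t)).
Proof.
move=> cX t; apply/cvgrPdist_lt => e e0; have e2 : 0 < e / 2 by rewrite divr_gt0.
have : \forall t' \near t, forall i, `|X i t - X i t'| < e / 2.
  by apply: filter_forall => i; have /cvgrPdist_lt := cX i t; exact.
apply: filterS => t' tt'.
have le1 : pivot (X^~ t') <= pivot (X^~ t) + e / 2.
  by apply: pivot_le (pivotP _) (pivotP _) _ => i; exact/ltW.
have le2 : pivot (X^~ t) <= pivot (X^~ t') + e / 2.
  by apply: pivot_le (pivotP _) (pivotP _) _ => i; rewrite distrC; exact/ltW.
by rewrite ltr_norml; apply/andP; split; lra.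
Qed.

(** * An equivariant map from the sphere to the box complex *)

(** Half of the mean of |u i|: it is exceeded by some |u i|. *)
Definition threshold u : R := (\sum_i `|u i|) / (2 * d.+2%:R).

(** Positive exactly when A contains all the i with u i <= - threshold u and
    only elements i with u i < 0. *)
Definition set_weight (A : {set I}) u : R :=
  (\prod_(j in A) Num.max (- u j) 0) *
  (\prod_(j | j \notin A) Num.max (u j + threshold u) 0).

Definition vertex_weight (v : I * {set I}) u : R :=
  Num.max (u v.1 - threshold u) 0 * set_weight v.2 u.

Definition weight y u : R :=
  vertex_weight y.1 (if y.2 then fun i => - u i else u).

Lemma thresholdN u : threshold (fun i => - u i) = threshold u.
Proof. by congr (_ / _); apply: eq_bigr => i _; rewrite normrN. Qed.

Lemma threshold_ge0 u : 0 <= threshold u.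
Proof. by rewrite divr_ge0// sumr_ge0. Qed.

Lemma weightN y u : weight y (fun i => - u i) = weight (y.1, ~~ y.2) u.
Proof.
rewrite /weight; case: y => v [] //=; congr vertex_weight.
by apply/funext => i; rewrite opprK.
Qed.

Lemma max0_ge0 (a : R) : 0 <= Num.max a 0.
Proof. by rewrite le_max lexx orbT. Qed.

Lemma max0_gt0 (a : R) : (0 < Num.max a 0) = (0 < a).
Proof. by rewrite lt_max ltxx orbF. Qed.

Lemma weight_ge0 y u : 0 <= weight y u.
Proof.
by rewrite /weight /vertex_weight /set_weight !mulr_ge0 ?prodr_ge0 ?max0_ge0//
  => *; exact: max0_ge0.
Qed.

Lemma prod_max0_gt0 (P : pred I) (F : I -> R) :
  (0 < \prod_(j | P j) Num.max (F j) 0) <-> forall j, P j -> 0 < F j.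
Proof.
split=> [|PF]; last by apply: prodr_gt0 => j /PF; rewrite max0_gt0.
move=> p0 j Pj; rewrite -max0_gt0 lt_neqAle max0_ge0 andbT.
by apply: contraTN p0 => /eqP Fj; rewrite (bigD1 j)//= -Fj mul0r ltxx.
Qed.

Lemma vertex_weight_gt0 v u : 0 < vertex_weight v u <->
  [/\ threshold u < u v.1, forall j, j \in v.2 -> u j < 0 &
      forall j, j \notin v.2 -> - threshold u < u j].
Proof.
have ge0 (P : pred I) (F : I -> R) : 0 <= \prod_(j | P j) Num.max (F j) 0.
  by apply: prodr_ge0 => j _; exact: max0_ge0.
split.
  rewrite /vertex_weight /set_weight => w0.
  have [a0 [b0 c0]] : 0 < Num.max (u v.1 - threshold u) 0 /\
      (0 < \prod_(j in v.2) Num.max (- u j) 0 /\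
       0 < \prod_(j | j \notin v.2) Num.max (u j + threshold u) 0).
    rewrite !lt_neqAle !ge0 max0_ge0 !andbT.
    by move: w0; rewrite lt_neqAle => /andP[+ _];
      rewrite eq_sym !mulf_eq0 !negb_or => /andP[? /andP[? ?]]; rewrite !(eq_sym 0).
  split; first by move: a0; rewrite max0_gt0 subr_gt0.
    by move=> j jA; rewrite -oppr_gt0; exact: (prod_max0_gt0 _ _).1 b0 j jA.
  by move=> j jA; rewrite -subr_gt0 opprK; exact: (prod_max0_gt0 _ _).1 c0 j jA.
move=> [u0 uA uC]; rewrite !mulr_gt0 ?max0_gt0 ?subr_gt0//.
  by apply/prod_max0_gt0 => j /uA; rewrite oppr_gt0.
by apply/prod_max0_gt0 => j /uC; rewrite -subr_gt0 opprK.
Qed.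

Definition weight_support u : {set I * {set I} * bool} :=
  [set y | 0 < weight y u]%SET.

(** The set of a vertex active on the negative side contains all the colors where u
    is at least the threshold, hence the colors of all the vertices active on the
    positive side; so active vertices of opposite sides are adjacent. *)
Lemma weight_support_box u :
  losing [set i | 0 < u i]%SET -> losing [set i | u i < 0]%SET ->
  weight_support u \in box_complex selfdual_graph.
Proof.
move=> posL negL.
pose part b := [set v | 0 < weight (v, b) u]%SET.
have adjP v w : v \in part false -> w \in part true -> selfdual_adj v w.
  rewrite !inE /weight /= => /vertex_weight_gt0[v0 vA vC].
  move=> /vertex_weight_gt0[]; rewrite thresholdN => w0 wA wC.
  have t0 := threshold_ge0 u.
  apply/and5P; split; last (apply/andP; split).
  - by apply: contraT => /wC; rewrite ltrN2; lra.
  - by apply: contraT => /vC; lra.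
  - by apply/negP => /vA; lra.
  - by apply/negP => /wA; lra.
  - by apply: losingS negL; apply/fintype.subsetP => j /vA; rewrite inE.
  - apply: losingS posL; apply/fintype.subsetP => j /wA; rewrite inE; lra.
rewrite inE; apply/existsP; exists (part false); apply/existsP; exists (part true).
apply/and3P; split.
- by apply/eqP/setP => -[v b]; rewrite uplusE !inE; case: b.
- rewrite disjoint_subset; apply/fintype.subsetP => v vS; rewrite inE.
  by apply/negP => /(adjP _ _ vS); rewrite selfdual_adj_irr.
- by apply/forall_inP => v vS; apply/forall_inP => w wT; exact: adjP.
Qed.

Definition total_weight u : R := \sum_y weight y u.

Lemma total_weight_gt0 u : (exists i, u i != 0) -> 0 < total_weight u.
Proof.
move=> [i0 ui0].
have s0 : 0 < \sum_i `|u i|.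
  rewrite (bigD1 i0)//= ltr_pwDl ?normr_gt0//.
  by apply: sumr_ge0 => i _.
have t0 : 0 < threshold u by rewrite divr_gt0// mulr_gt0.
have [i ui] : exists i, threshold u < `|u i|.
  apply: contrapT => /forallNP ui.
  have : \sum_i `|u i| <= \sum_(i < d.+2) threshold u.
    by apply: ler_sum => i _; rewrite leNgt; apply/negP.
  rewrite sumr_const card_ord -[threshold u *+ _]mulr_natr.
  have -> : threshold u * d.+2%:R = (\sum_i `|u i|) / 2.
    have : d.+2%:R != 0 :> R by rewrite pnatr_eq0.
    by rewrite /threshold; move: (d.+2%:R) => m m0; field.
  by lra.
have pos u' : threshold u' = threshold u -> threshold u < u' i ->
    0 < vertex_weight (i, [set j | u' j <= - threshold u]%SET) u'.
  move=> tu' u'i; apply/vertex_weight_gt0; rewrite tu'; split=> //= j.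
    by rewrite inE; lra.
  by rewrite inE -ltNge.
have [z z0] : exists y, 0 < weight y u.
  have [u0|u0] := ltP (u i) 0; last first.
    by rewrite ger0_norm// in ui; exists (i, [set j | u j <= - threshold u]%SET, false); exact: pos.
  rewrite ltr0_norm// in ui.
  exists (i, [set j | - u j <= - threshold u]%SET, true).
  by apply: (pos (fun i => - u i)) => //; exact: thresholdN.
rewrite /total_weight (bigD1 z)//= ltr_pwDl// sumr_ge0// => y _.
exact: weight_ge0.
Qed.

Lemma weight_realization u : (exists i, u i != 0) ->
  losing [set i | 0 < u i]%SET -> losing [set i | u i < 0]%SET ->
  realization_set (box_complex selfdual_graph)
    (fun y => weight y u / total_weight u : R).
Proof.
move=> /total_weight_gt0 tot posL negL.
exists (weight_support u); first exact: weight_support_box.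
have supp y : y \notin weight_support u -> weight y u = 0.
  by rewrite inE -leNgt => y0; apply/le_anti; rewrite y0 weight_ge0.
split=> [y _|y /supp ->|]; [|by rewrite mul0r|].
  by rewrite divr_ge0 ?weight_ge0// ltW.
rewrite -mulr_suml.
have -> : \sum_(y in weight_support u) weight y u = total_weight u.
  rewrite /total_weight [LHS]big_mkcond /=; apply: eq_bigr => y _.
  by case: ifPn => // /supp.
by rewrite divff ?gt_eqF.
Qed.

Section Continuity.
Variables (T : topologicalType) (U : I -> T -> R).
Hypothesis cU : forall i, continuous (U i).

Lemma cont_threshold : continuous (fun t => threshold (U^~ t)).
Proof.
apply: cont_mul; last exact: cont_cst.
by apply: cont_sum => i _; exact: cont_norm.
Qed.

Lemma cont_vertex_weight v : continuous (fun t => vertex_weight v (U^~ t)).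
Proof.
have cmax (F : T -> R) : continuous F -> continuous (fun t => Num.max (F t) 0).
  by move=> cF; apply: cont_maxr => //; exact: cont_cst.
apply: cont_mul.
  by apply/cmax/cont_sub => //; exact: cont_threshold.
apply: cont_mul; apply: cont_prod => j _; apply: cmax; first exact: cont_opp.
by apply: cont_add => //; exact: cont_threshold.
Qed.

End Continuity.

Lemma cont_weight (T : topologicalType) (U : I -> T -> R) y :
  (forall i, continuous (U i)) -> continuous (fun t => weight y (U^~ t)).
Proof.
move=> cU; rewrite /weight; case: (y.2); last exact: cont_vertex_weight.
apply: (cont_vertex_weight (U := fun i t => - U i t)) => i.
exact: cont_opp.
Qed.

(** A point of the sphere is completed by a coordinate 0, so that it represents
    a function up to the addition of constants. *)
Let extended (p : sphere R d) (i : I) : R :=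
  if insub (i : nat) is Some j then (set_val p : 'rV[R]_d.+1) 0 j else 0.

Let pivoted (p : sphere R d) (i : I) : R := extended p i - pivot (extended p).

Let cont_pivoted i : continuous (fun p => pivoted p i).
Proof.
have cE j : continuous (fun p => extended p j).
  rewrite /extended; case: insubP => [k _ _|_]; last exact: cont_cst.
  apply: (@cont_coord _ _ _ (fun p : sphere R d => (set_val p : 'rV_d.+1))).
  exact: continuous_set_val.
by apply: cont_sub => //; exact: (cont_pivot (X := fun j p => extended p j)).
Qed.

Let pivoted_neq0 p : exists i, pivoted p i != 0.
Proof.
apply: contrapT => /forallNP p0.
have ext_cst i : extended p i = pivot (extended p).
  by apply/eqP; rewrite -subr_eq0; apply: contraT => /p0.
have ext0 i : extended p i = 0.
  by rewrite ext_cst -(ext_cst ord_max) /extended insubN ?ltnn.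
have /eqP := set_valP p; rewrite big1 1?eq_sym ?oner_eq0// => j _.
have := ext0 (widen_ord (leqnSn _) j); rewrite /extended /= valK => ->.
by rewrite expr0n.
Qed.

Let pivotedN p : pivoted (z2inv p) = (fun i => - pivoted p i).
Proof.
have extN : extended (z2inv p) = (fun i => - extended p i).
  apply/funext => i; rewrite /extended; case: insubP => [j _ _|_].
    by rewrite /= mxE.
  by rewrite oppr0.
by apply/funext => i; rewrite /pivoted extN pivotN opprB opprK addrC.
Qed.

Let pivoted_point p : realization_set (box_complex selfdual_graph)
  (fun y => weight y (pivoted p) / total_weight (pivoted p) : R).
Proof.
have [gtL ltL] := pivotP (extended p).
apply: weight_realization; first exact: pivoted_neq0.
- by apply: losingS gtL; apply/fintype.subsetP => i; rewrite !inE subr_gt0.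
- by apply: losingS ltL; apply/fintype.subsetP => i; rewrite !inE subr_lt0.
Qed.

(** Subtracting its pivot from a non-constant function makes its sets of
    positive and of negative values losing, which is what the sets of active
    colors on both sides of a simplex of the box complex must be. *)
Lemma selfdual_graph_coind :
  (d%:R%:E <= coind R (box_space selfdual_graph R))%E.
Proof.
pose f (p : sphere R d) : box_space selfdual_graph R :=
  SigSub (mem_set (pivoted_point p)).
apply: (ge_coind (f := f)); split.
  apply: continuous_sub; apply: ptws_continuous => y.
  have cw z : continuous (fun p => weight z (pivoted p)).
    by apply: (cont_weight _ (U := fun i p => pivoted p i)); exact: cont_pivoted.
  apply: cont_mul; first exact: cw.
  apply: cont_inv => [|p]; first by apply: cont_sum => z _; exact: cw.
  by rewrite gt_eqF// total_weight_gt0//; exact: pivoted_neq0.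
move=> p; apply: val_inj; apply/funext => y /=.
rewrite /coord_act /= pivotedN.
have totN u : total_weight (fun i => - u i) = total_weight u.
  rewrite /total_weight (reindex_inj (inv_inj (@swapK selfdual_graph))) /=.
  by apply: eq_bigr => z _; rewrite weightN /= negbK; case: z.
by rewrite totN weightN.
Qed.

End SelfDual.

(** * The majority graph *)

Section Majority.
Variables (R : realType) (r : nat) (r_gt0 : (0 < r)%N).

Let d := (2 * r).-1.
Let dE : d.+1 = (2 * r)%N.
Proof. by rewrite prednK// muln_gt0. Qed.

Definition minority : pred {set 'I_d.+2} := fun A => (#|A| <= r)%N.

Lemma minorityS (A B : {set 'I_d.+2}) : A \subset B -> minority B -> minority A.
Proof. by move=> /subset_leq_card; exact: leq_trans. Qed.

Lemma minorityC (A : {set 'I_d.+2}) : minority (~: A)%SET = ~~ minority A.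
Proof.
have AC : (#|A| + #|~: A|%SET)%N = (2 * r).+1 by rewrite cardsC card_ord dE.
by rewrite /minority -ltnNge; apply/idP/idP; lia.
Qed.

Definition majority_graph := selfdual_graph minority.

Lemma majority_graph_topologically_chromatic :
  topologically_chromatic R (2 * r) majority_graph.
Proof.
rewrite /topologically_chromatic -dE -addn1 natrD addrK.
exact: selfdual_graph_coind minorityS minorityC _.
Qed.

Definition vertex_color (v : majority_graph) : nat := v.1.

Lemma vertex_color_proper : proper_coloring vertex_color.
Proof.
move=> v w /and5P[vw _ _ w0 _] /ord_inj vwE.
by move: w0; rewrite -vwE vw.
Qed.

Lemma num_vertex_colors : num_colors vertex_color = (2 * r + 1)%N.
Proof.
rewrite addn1 -dE -[RHS](size_iota 0); apply: perm_size.
apply: uniq_perm; [exact: undup_uniq|exact: iota_uniq|move=> k].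
rewrite mem_undup mem_iota /= add0n; apply/mapP/idP => [[v _ ->]|kd]; first exact: ltn_ord.
by exists (Ordinal kd, finset.set0) => //; rewrite mem_enum.
Qed.

(** The colors around (i, A) are in A, and A is losing if there are any. *)
Lemma nbr_vertex_colors v : (nbr_colors vertex_color v <= r)%N.
Proof.
have [vL|vL] := boolP (minority v.2); last first.
  rewrite /nbr_colors (eq_filter (a2 := pred0)) ?filter_pred0// => w.
  by apply/negbTE/negP => /and5P[_ _ _ _ /andP[/negP]]; rewrite (negbTE vL).
apply: leq_trans vL; rewrite cardE -(size_map (@nat_of_ord _)).
apply: uniq_leq_size (undup_uniq _) _ => k.
rewrite mem_undup => /mapP[w]; rewrite mem_filter => /andP[/and5P[_ wv _ _ _] _ ->].
by apply: map_f; rewrite mem_enum.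
Qed.

End Majority.

Lemma local_value_ge (R : realType) (r : nat) (G : sgraph) (c : G -> nat) :
  (0 < r)%N -> topologically_chromatic R (2 * r) G -> proper_coloring c ->
  (r < local_value c)%N.
Proof.
move=> r0 topG cP.
have [v rv] := topologically_chromatic_nbr_colors r0 topG cP.
rewrite /local_value ltnS; apply: leq_trans rv _.
exact: (@leq_bigmax _ (nbr_colors c)).
Qed.

Lemma majority_graph_local_chromatic (R : realType) (r : nat) : (0 < r)%N ->
  local_value (@vertex_color r) = (r + 1)%N /\
  local_chromatic_number (majority_graph r) = (r + 1)%N.
Proof.
move=> r0; have topG := majority_graph_topologically_chromatic R r0.
have lv : local_value (@vertex_color r) = (r + 1)%N.
  apply/eqP; rewrite eqn_leq addn1.
  rewrite (local_value_ge r0 topG (@vertex_color_proper r)) andbT ltnS.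
  by apply/bigmax_leqP => v _; exact: nbr_vertex_colors.
split=> //; rewrite /local_chromatic_number; case: ex_minnP => k kP kmin.
apply/eqP; rewrite eqn_leq kmin; last first.
  by apply/asboolP; exists (@vertex_color r); split=> //; exact: vertex_color_proper.
have [c [cP <-]] := asboolP _ kP.
by rewrite addn1; exact: local_value_ge topG cP.
Qed.

(** * Square roots of complex-valued functions on a ball *)

Section ComplexSquareRoots.
Variable R : realType.

(** The complex number v.1 + i v.2 is a square root of w.1 + i w.2. *)
Definition csqrt_of (v w : R * R) : Prop :=
  v.1 ^+ 2 - v.2 ^+ 2 = w.1 /\ 2 * (v.1 * v.2) = w.2.

(** Complex numbers have no zero divisors; the product of the squared moduli of
    v' - v and v' + v is the squared modulus of the difference of the squares. *)
Lemma csqrt_unique v v' w : csqrt_of v w -> csqrt_of v' w ->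
  v' = v \/ v' = (- v.1, - v.2).
Proof.
case: v v' w => [p q] [p' q'] [c s] [/= e1 e2] [/= e3 e4].
have : ((p' - p) ^+ 2 + (q' - q) ^+ 2) * ((p' + p) ^+ 2 + (q' + q) ^+ 2) = 0.
  transitivity (((p' ^+ 2 - q' ^+ 2) - (p ^+ 2 - q ^+ 2)) ^+ 2 +
    (2 * (p' * q') - 2 * (p * q)) ^+ 2); first by ring.
  by rewrite e1 e2 e3 e4 !subrr expr0n addr0.
have zero (a b : R) : a ^+ 2 + b ^+ 2 = 0 -> a = 0 /\ b = 0.
  move=> /eqP; rewrite paddr_eq0 ?sqr_ge0// !sqrf_eq0.
  by move=> /andP[/eqP -> /eqP ->].
move=> /eqP; rewrite mulf_eq0 => /orP[]/eqP/zero[h1 h2]; [left|right].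
  by congr pair; lra.
by congr pair; lra.
Qed.

Lemma exists_csqrt w : exists v, csqrt_of v w.
Proof.
case: w => c s; pose r := Num.sqrt (c ^+ 2 + s ^+ 2).
have r0 : 0 <= r by exact: sqrtr_ge0.
have r2 : r ^+ 2 = c ^+ 2 + s ^+ 2 by rewrite sqr_sqrtr// addr_ge0 ?sqr_ge0.
have cr : `|c| <= r.
  by rewrite -ler_sqr ?nnegrE ?normr_ge0// -normrX ger0_norm ?sqr_ge0// r2 lerDl sqr_ge0.
move: cr; rewrite ler_norml => /andP[cr1 cr2].
have P2 : Num.sqrt ((r + c) / 2) ^+ 2 = (r + c) / 2 by rewrite sqr_sqrtr//; lra.
have Q2 : Num.sqrt ((r - c) / 2) ^+ 2 = (r - c) / 2 by rewrite sqr_sqrtr//; lra.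
have PQ : Num.sqrt ((r + c) / 2) * Num.sqrt ((r - c) / 2) = `|s| / 2.
  rewrite -sqrtrM; last by lra.
  rewrite -[RHS]ger0_norm ?divr_ge0// -sqrtr_sqr; congr Num.sqrt.
  by rewrite expr_div_n real_normK ?num_real//; lra.
have [s0|s0] := leP 0 s.
  exists (Num.sqrt ((r + c) / 2), Num.sqrt ((r - c) / 2)); split=> /=.
    by rewrite P2 Q2; lra.
  by rewrite PQ ger0_norm//; lra.
exists (Num.sqrt ((r + c) / 2), - Num.sqrt ((r - c) / 2)); split=> /=.
  by rewrite sqrrN P2 Q2; lra.
by rewrite mulrN PQ ltr0_norm//; lra.
Qed.

Definition has_csqrt (T : topologicalType) (D : set T) (c s : T -> R) : Prop :=
  exists p q : T -> R, [/\ continuous p, continuous q &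
    forall t, D t -> csqrt_of (p t, q t) (c t, s t)].

(** The quotient of the two functions takes its values in the open right half
    plane, where the square root is continuous. *)
Lemma has_csqrt_near (T : topologicalType) (D : set T) (c s c' s' : T -> R) :
  continuous c -> continuous s -> continuous c' -> continuous s' ->
  (forall t, 0 < c t * c' t + s t * s' t) ->
  has_csqrt D c s -> has_csqrt D c' s'.
Proof.
move=> cc cs cc' cs' pos [p [q [cp cq pq]]].
pose m t := c t ^+ 2 + s t ^+ 2.
have m0 t : m t != 0.
  apply/negP; rewrite paddr_eq0 ?sqr_ge0// !sqrf_eq0 => /andP[/eqP c0 /eqP s0].
  by have := pos t; rewrite c0 s0 !mul0r addr0 ltxx.
have m_gt0 t : 0 < m t by rewrite lt_neqAle eq_sym m0 addr_ge0// sqr_ge0.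
pose a t := (c t * c' t + s t * s' t) / m t.
pose b t := (s' t * c t - c' t * s t) / m t.
have a0 t : 0 < a t by rewrite divr_gt0.
pose h t := (Num.sqrt (a t ^+ 2 + b t ^+ 2) + a t) / 2.
have h0 t : 0 < h t by rewrite divr_gt0// ltr_wpDl// sqrtr_ge0.
pose A t := Num.sqrt (h t).
have A0 t : A t != 0 by rewrite gt_eqF// sqrtr_gt0.
pose B t := b t / (2 * A t).
have cm : continuous m by apply: cont_add; exact: cont_exp.
have cmi : continuous (fun t => (m t)^-1) by exact: cont_inv.
have ca : continuous a.
  by apply: cont_mul => //; apply: cont_add; exact: cont_mul.
have cb : continuous b.
  by apply: cont_mul => //; apply: cont_sub; exact: cont_mul.
have cA : continuous A.
  apply: cont_sqrt; apply: cont_mul; last exact: cont_cst.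
  apply: cont_add => //; apply: cont_sqrt.
  by apply: cont_add; exact: cont_exp.
have cB : continuous B.
  apply: cont_mul => //; apply: cont_inv => [|t].
    by apply: cont_mul => //; exact: cont_cst.
  by rewrite mulf_neq0// pnatr_eq0.
exists (fun t => p t * A t - q t * B t), (fun t => p t * B t + q t * A t).
split; [by apply: cont_sub; exact: cont_mul|by apply: cont_add; exact: cont_mul|].
move=> t /pq[/= pqc pqs].
have AB : A t ^+ 2 - B t ^+ 2 = a t /\ 2 * (A t * B t) = b t.
  have A2 : A t ^+ 2 = h t by rewrite sqr_sqrtr// ltW.
  split; last by rewrite /B; field; exact: A0.
  have r2 : Num.sqrt (a t ^+ 2 + b t ^+ 2) ^+ 2 = a t ^+ 2 + b t ^+ 2.
    by rewrite sqr_sqrtr// addr_ge0 ?sqr_ge0.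
  have hE : b t ^+ 2 = 4 * h t * (h t - a t).
    by rewrite /h; move: r2; set r := Num.sqrt _ => r2; lra.
  have -> : B t ^+ 2 = b t ^+ 2 / (4 * A t ^+ 2).
    by rewrite /B; move: (b t) (A t) (A0 t) => b' a' a0'; field.
  rewrite A2 hE.
  by move: (lt0r_neq0 (h0 t)) => hn; field.
have ms : c t * a t - s t * b t = c' t /\ c t * b t + s t * a t = s' t.
  by split; rewrite /a /b /m; move: (m0 t); rewrite /m => mt; field.
move: AB ms => [AB1 AB2] [ms1 ms2]; split=> /=.
  rewrite -ms1 -AB1 -AB2 -pqc -pqs; ring.
by rewrite -ms2 -AB1 -AB2 -pqc -pqs; ring.
Qed.

Variable n : nat.
Notation V := 'rV[R]_n.

(** A retraction onto the cube, making continuous functions globally defined. *)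
Let clamp (x : V) : V := \row_j Num.max (-1) (- Num.max (-1) (- x 0 j)).

Let clamp_cube x : cube (clamp x).
Proof.
move=> j; rewrite mxE ler_norml le_max lexx /= ge_max.
apply/andP; split; first by lra.
by rewrite lerNl le_max lexx.
Qed.

Let clampE x : cube x -> clamp x = x.
Proof.
move=> xC; apply/rowP => j; rewrite mxE; have := xC j.
rewrite ler_norml => /andP[x1 x2].
by rewrite [Num.max (-1) (- x 0 j)]max_r ?max_r ?opprK//; lra.
Qed.

Let cont_clamp_scale (a : R) : continuous (fun x => a *: clamp x).
Proof.
have -> : (fun x => a *: clamp x) = fun x =>
    \row_j (a * Num.max (-1) (- Num.max (-1) (- x 0 j))).
  by apply/funext => x; apply/rowP => j; rewrite !mxE.
apply: cont_row => j; apply: cont_mul; first exact: cont_cst.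
have cx : continuous (fun x : V => - x 0 j) by apply/cont_opp/coord_continuous.
apply: cont_maxr; first exact: cont_cst.
by apply/cont_opp/cont_maxr => //; exact: cont_cst.
Qed.

(** A square root is continued along the segments issued from the origin, in
    finitely many steps thanks to uniform continuity. *)
Lemma has_csqrt_cube (c s : V -> R) : continuous c -> continuous s ->
  (forall x, c x ^+ 2 + s x ^+ 2 != 0) -> has_csqrt cube c s.
Proof.
move=> cc cs cs0; pose F x := c x ^+ 2 + s x ^+ 2.
have cF : continuous F by apply: cont_add; exact: cont_exp.
have F0 x : 0 < F x by rewrite lt_neqAle eq_sym cs0 addr_ge0// sqr_ge0.
have [x0 _ Fmin] : exists2 x, x \in @cube R n &
    forall t, t \in @cube R n -> F x <= F t.
  apply: EVT_min_rV; [|exact: compact_cube|exact: continuous_subspaceT].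
  by exists 0 => j; rewrite mxE normr0.
pose m := F x0; have m0 : 0 < m := F0 x0.
have {}Fmin x : cube x -> m <= F x by move=> xC; apply: Fmin; rewrite inE.
(* Both e < 1 and e < m, so that e ^+ 2 < m. *)
pose e := m / (m + 1).
have m1 : 0 < m + 1 by rewrite addr_gt0.
have e0 : 0 < e by rewrite divr_gt0.
have e2 : e ^+ 2 < m.
  have em : e < m.
    by rewrite /e ltr_pdivrMr//; have := mulr_gt0 m0 m0; move: m {Fmin e e0 m1} m0 => m; nra.
  have e1 : e < 1 by rewrite /e ltr_pdivrMr// mul1r ltrDl.
  by rewrite expr2 (lt_trans _ em)// -[ltRHS]mulr1 ltr_pM2l.
have [d [[d0 dc] ds]] := filter_ex (filterI (filterI (nbhs_right_gt (0 : R))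
  (cube_heine cc e0)) (cube_heine cs e0)).
pose N := (Num.bound d^-1).+1.
have Nd : N%:R^-1 < d :> R.
  rewrite invf_plt ?posrE ?ltr0n//; apply: lt_trans (_ : (Num.bound d^-1)%:R < _).
    by apply: archi_boundP; rewrite invr_ge0 ltW.
  by rewrite ltr_nat.
pose pt k x := (k%:R / N%:R) *: clamp x.
have ptC k x : (k <= N)%N -> cube (pt k x).
  move=> kN j; rewrite mxE normrM ger0_norm ?divr_ge0//.
  by rewrite mulr_ile1 ?divr_ge0// ?ler_pdivrMr ?ltr0n// ?mul1r ?ler_nat//; exact: clamp_cube.
have cpt (g : V -> R) k : continuous g -> continuous (fun x => g (pt k x)).
  move=> cg x; apply: (@continuous_comp _ _ _ (pt k) g); last exact: cg.
  exact: cont_clamp_scale.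
suff key k : (k <= N)%N -> has_csqrt cube (fun x => c (pt k x)) (fun x => s (pt k x)).
  have [p [q [cp cq pq]]] := key N (leqnn _); exists p, q; split=> // x xC.
  by have := pq x xC; rewrite /pt divff ?pnatr_eq0// scale1r clampE.
elim: k => [_|k IH kN].
  have [[p q] pq] := exists_csqrt (c 0, s 0).
  exists (fun=> p), (fun=> q); split; try exact: cont_cst.
  by move=> x _; rewrite /pt mul0r scale0r.
apply: has_csqrt_near (IH (ltnW kN)); try exact: cpt.
move=> x.
have close j : `|pt k x 0 j - pt k.+1 x 0 j| < d.
  rewrite [pt k x 0 j]mxE [pt k.+1 x 0 j]mxE -mulrBl -mulrBl -natr1.
  rewrite opprD addrA subrr add0r mulN1r.
  rewrite normrM normrN [`|N%:R^-1|]ger0_norm ?invr_ge0//.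
  rewrite (le_lt_trans _ Nd)// -[leRHS]mulr1 ler_wpM2l ?invr_ge0//.
  exact: clamp_cube.
have := dc _ _ (ptC k x (ltnW kN)) close; have := ds _ _ (ptC k x (ltnW kN)) close.
have := Fmin _ (ptC k x (ltnW kN)); have := Fmin _ (ptC k.+1 x kN).
rewrite /F; move: (c (pt k x)) (s (pt k x)) (c (pt k.+1 x)) (s (pt k.+1 x)).
move=> c1 s1 c2 s2 h2 h1 /ltr_normlP[hs1 hs2] /ltr_normlP[hc1 hc2].
have sq (z : R) : - z < e -> z < e -> z ^+ 2 < e ^+ 2 by move=> ? ?; nra.
have := sq _ hs1 hs2; have := sq _ hc1 hc2; nra.
Qed.

End ComplexSquareRoots.

(** * Connectedness of the sphere *)

Section SphereConnected.
Variables (R : realType) (n : nat) (n_gt1 : (1 < n)%N).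
Notation V := 'rV[R]_n.

(** The line through x and a vector of the canonical basis not proportional to
    x avoids the origin, so that its projection to the sphere is a path. *)
Lemma sphere_antipode_gt0 (g : V -> R) : continuous g ->
  (forall x, l1 x = 1 -> g x != 0) ->
  forall x, l1 x = 1 -> 0 < g x -> 0 < g (- x).
Proof.
move=> cg g0 x x1.
have [i xi] : exists i, x 0 i != 0.
  apply: contrapT => /forallNP x0; move: x1; rewrite /l1 big1 => [/eqP|i _].
    by rewrite eq_sym oner_eq0.
  by apply/normr0P/negP => xi; apply: (x0 i); apply/negP.
have [j ji] : exists j : 'I_n, j != i.
  have [i0|i0] := eqVneq (i : nat) 0%N.
    by exists (Ordinal n_gt1); rewrite -val_eqE /= i0.
  by exists (Ordinal (ltnW n_gt1)); rewrite -val_eqE /= eq_sym.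
have step (h : V -> R) (z : V) : continuous h -> (forall x, l1 x = 1 -> h x != 0) ->
    z 0 i != 0 -> l1 z = 1 -> 0 < h z -> 0 < h (delta_mx 0 j).
  move=> ch h0 zi z1 hz; pose w t : V := t *: delta_mx 0 j + (1 - t) *: z.
  have w0 t : l1 (w t) != 0.
    apply/negP => /eqP/psumr_eq0P wt.
    have {}wt k : w t 0 k = 0 by apply/normr0_eq0/wt => //.
    have := wt i; rewrite !mxE eqxx (eq_sym i) (negbTE ji) mulr0 add0r.
    move=> /eqP; rewrite mulf_eq0 (negbTE zi) orbF subr_eq0 => /eqP t1.
    have := wt j; rewrite !mxE !eqxx mulr1 -t1 subrr mul0r addr0 => /eqP.
    by rewrite oner_eq0.
  have w_gt0 t : 0 < l1 (w t) by rewrite lt_neqAle eq_sym w0 sumr_ge0.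
  pose u t : V := \row_k (w t 0 k / l1 (w t)).
  have u1 t : l1 (u t) = 1.
    rewrite /l1; under eq_bigr => k _ do
      rewrite mxE normrM normfV (ger0_norm (ltW (w_gt0 t))).
    by rewrite -mulr_suml -/(l1 (w t)) divff.
  have cw k : continuous (fun t => w t 0 k).
    have -> : (fun t => w t 0 k) =
        fun t => t * (delta_mx 0 j : V) 0 k + (1 - t) * z 0 k.
      by apply/funext => t; rewrite !mxE.
    have cid : continuous (fun t : R => t) by move=> t; exact: cvg_id.
    apply: cont_add; apply: cont_mul; try exact: cont_cst; first exact: cid.
    by apply: cont_sub => //; exact: cont_cst.
  have cu : continuous u.
    apply: cont_row => k; apply: cont_mul; first exact: cw.
    by apply: cont_inv => //; apply: cont_sum => k' _; exact: cont_norm.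
  have chu : continuous (h \o u).
    by move=> t; apply: continuous_comp; [exact: cu|exact: ch].
  have uE t (v : V) : w t = v -> l1 v = 1 -> u t = v.
    by move=> wt v1; apply/rowP => k; rewrite mxE wt v1 divr1.
  have u0 : u 0 = z by apply: uE => //; rewrite /w scale0r add0r subr0 scale1r.
  have w1 : w 1 = delta_mx 0 j by rewrite /w scale1r subrr scale0r addr0.
  have u1' : u 1 = delta_mx 0 j.
    apply: uE w1 _; rewrite /l1 (bigD1 j)//= mxE !eqxx normr1 big1 ?addr0// => k kj.
    by rewrite mxE (negbTE kj) andbF normr0.
  rewrite ltNge; apply/negP => hj.
  have [||t _ ht] := @IVT R (h \o u) 0 1 0 ler01.
  - exact: continuous_subspaceT.
  - by rewrite /= u0 u1' ge_min hj orbT le_max (ltW hz).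
  - by have := h0 _ (u1 t); rewrite -[h (u t)]/((h \o u) t) ht eqxx.
move=> gx; have xN1 : l1 (- x) = 1.
  by rewrite -x1; apply: eq_bigr => k _; rewrite mxE normrN.
rewrite lt_neqAle eq_sym g0//= leNgt; apply/negP => gNx.
have := step g x cg g0 xi x1 gx; apply/negP; rewrite -leNgt -oppr_ge0 ltW//.
apply: (step (fun z => - g z) (- x)) => //; first exact: cont_opp.
- by move=> z /g0; rewrite oppr_eq0.
- by rewrite mxE oppr_eq0.
- by rewrite oppr_gt0.
Qed.

End SphereConnected.

(** * Points of the hom space of a graph built from a self-dual family *)

Section HomPoints.
Variables (R : realType) (d : nat) (losing : pred {set 'I_d.+2}).
Hypothesis losingS :
  forall A B : {set 'I_d.+2}, A \subset B -> losing B -> losing A.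
Notation G := (selfdual_graph losing).

Definition color_weight (p : box_space G R) (i : 'I_d.+2) : R :=
  \sum_(A : {set 'I_d.+2}) signed_weight p ((i, A) : G).

Lemma color_weightN p i : color_weight (z2inv p) i = - color_weight p i.
Proof.
by rewrite /color_weight -sumrN; apply: eq_bigr => A _; exact: signed_weightN.
Qed.

Lemma cont_color_weight i : continuous (fun p => color_weight p i).
Proof. by apply: cont_sum => A _; exact: cont_signed_weight. Qed.

(** The shape of the color weights of points of the hom space: their positive and
    negative parts have losing supports and mass 1/2. *)
Definition balanced (w : 'I_d.+2 -> R) : Prop :=
  [/\ losing [set i | 0 < w i]%SET, losing [set i | w i < 0]%SET,
      \sum_i Num.max (w i) 0 = 1 / 2 & \sum_i Num.max (- w i) 0 = 1 / 2].

Lemma balancedN w : balanced w -> balanced (fun i => - w i).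
Proof.
move=> [wp wn sp sn]; split=> //.
- by rewrite (_ : finset _ = [set i | w i < 0]%SET)//;
    apply/setP => i; rewrite !inE oppr_gt0.
- by rewrite (_ : finset _ = [set i | 0 < w i]%SET)//;
    apply/setP => i; rewrite !inE oppr_lt0.
- by under eq_bigr do rewrite opprK.
Qed.

(** A color has no weight on both sides, because a vertex (i, A) is adjacent to no
    vertex (i, B). The colors with weight on one side belong to the second
    component of any active vertex of the other side, and both sides are nonempty
    in the hom space. *)
Lemma hom_set_balanced p : hom_set p -> balanced (color_weight p).
Proof.
move=> hp; have [a0 a1 aE] := barycoordP p.
pose mass b i := \sum_(A : {set 'I_d.+2}) barycoord p ((i, A) : G, b).
have mass_sum b : \sum_i mass b i = \sum_(v : G) barycoord p (v, b).
  by rewrite pair_big /=; apply: eq_bigr => -[].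
have half b : \sum_i mass b i = 1 / 2.
  rewrite mass_sum; case: b; last exact: hp.
  move: a1 hp; rewrite sum_barycoord /hom_set /= => + hp.
  by rewrite hp; lra.
have mass0 b i : 0 <= mass b i by apply: sumr_ge0.
have mass_gt0 b i : 0 < mass b i -> exists A, 0 < barycoord p ((i, A) : G, b).
  move=> m0; apply: contrapT => /forallNP noA; move: m0; rewrite /mass big1 ?ltxx// => A _.
  by apply/eqP; rewrite eq_le a0 andbT leNgt; apply/negP/noA.
have active b : exists v, 0 < barycoord p (v, b).
  apply: contrapT => /forallNP nov; have := half b; rewrite mass_sum big1 => [|v _].
    by lra.
  by apply/eqP; rewrite eq_le a0 andbT leNgt; apply/negP/nov.
have massE i : color_weight p i = mass false i - mass true i.
  by rewrite /color_weight sumrB.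
have disjoint i : mass false i = 0 \/ mass true i = 0.
  have [|m0] := eqVneq (mass false i) 0; first by left.
  right; apply/eqP; rewrite eq_le mass0 andbT leNgt; apply/negP => /mass_gt0[B iB].
  have /mass_gt0[A iA] : 0 < mass false i by rewrite lt_neqAle eq_sym m0 mass0.
  by have /and5P[/= iB' _ _ /negP] := aE _ _ iA iB.
have posE i : Num.max (color_weight p i) 0 = mass false i.
  rewrite massE; case: (disjoint i) => ->; last by rewrite subr0 max_l.
  by rewrite sub0r max_r// oppr_le0.
have negE i : Num.max (- color_weight p i) 0 = mass true i.
  rewrite massE; case: (disjoint i) => ->; first by rewrite sub0r opprK max_l.
  by rewrite subr0 max_r// oppr_le0.
split; last 2 first.
- by under eq_bigr do rewrite posE.
- by under eq_bigr do rewrite negE.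
- have [[j B] jB] := active true.
  have [[k C] kC] := active false.
  have /and5P[_ _ _ _ /andP[_ BL]] := aE _ _ kC jB.
  apply: losingS BL; apply/fintype.subsetP => i; rewrite inE => wi.
  have /mass_gt0[A iA] : 0 < mass false i by rewrite -posE lt_max wi.
  by have /and5P[] := aE _ _ iA jB.
- have [[j B] jB] := active true.
  have [[k C] kC] := active false.
  have /and5P[_ _ _ _ /andP[CL _]] := aE _ _ kC jB.
  apply: losingS CL; apply/fintype.subsetP => i; rewrite inE => wi.
  have /mass_gt0[A iA] : 0 < mass true i by rewrite -negE lt_max oppr_gt0 wi.
  by have /and5P[] := aE _ _ kC iA.
Qed.

End HomPoints.

(** * The handle graph *)

Section Handle.
Variables (n : nat) (n_gt0 : (0 < n)%N).
Notation I := 'I_n.+3.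

Let z0 : I := @Ordinal n.+3 0 isT.
Let z1 : I := @Ordinal n.+3 1 isT.
Let z2 : I := @Ordinal n.+3 2 isT.
Let tail (j : 'I_n) : I := rshift 3 j.

(** The family of the sets that do not contain 0, modified by exchanging the sets
    {0}, {0, 1} and {0, 2} with their complements. The edges {1, 0} and {0, 2} of
    the new simplicial complex form an arc from 1 to 2, which is the core of the
    handle; the colors of the tail play symmetric roles. *)
Definition handle_losing : pred {set I} := fun A =>
  if z0 \in A then [forall j, tail j \notin A] && ~~ ((z1 \in A) && (z2 \in A))
  else [forall j, tail j \in A] ==> (z1 \notin A) && (z2 \notin A).

Lemma handle_losingC (A : {set I}) : handle_losing (~: A)%SET = ~~ handle_losing A.
Proof.
have outE : [forall j, tail j \in (~: A)%SET] = [forall j, tail j \notin A].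
  by apply: eq_forallb => j; rewrite inE.
have inE' : [forall j, tail j \notin (~: A)%SET] = [forall j, tail j \in A].
  by apply: eq_forallb => j; rewrite inE negbK.
rewrite /handle_losing outE inE' !inE !negbK.
case: (z0 \in A); case: (z1 \in A); case: (z2 \in A);
  by case: [forall j, _]; case: [forall j, _].
Qed.

Lemma handle_losingS (A B : {set I}) :
  A \subset B -> handle_losing B -> handle_losing A.
Proof.
move=> /fintype.subsetP AB; rewrite /handle_losing.
have out x : x \notin B -> x \notin A by apply: contra; exact: AB.
case: ifPn => [_|/out/negbTE ->].
  move=> /andP[/forallP tB TB]; have tA j : tail j \notin A by apply/out/tB.
  case: ifPn => _; last first.
    by apply/implyP => /forallP/(_ (Ordinal n_gt0)); rewrite (negbTE (tA _)).
  by apply/andP; split; [apply/forallP|apply: contra TB => /andP[/AB-> /AB->]].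
move=> /implyP TB; apply/implyP => /forallP tA.
have /TB/andP[/out-> /out->//] : [forall j, tail j \in B].
by apply/forallP => j; exact/AB/tA.
Qed.

Variable R : realType.
Implicit Types w : I -> R.

Lemma big_colors (F : I -> R) :
  \sum_i F i = F z0 + F z1 + F z2 + \sum_j F (tail j).
Proof.
rewrite (@big_split_ord _ _ _ 3 n) /= !big_ord_recl big_ord0 addr0 addrA.
by congr (F _ + F _ + F _ + _); apply: val_inj.
Qed.

(** The loop of the handle is parametrized by the positive part of w, up to
    scaling: on it, this complex number is the square of
    (a_1 - a_2) + i a_0, where a_i is the positive part of w i, and it is 1/4
    on the rest of the space. *)
Definition handle_coord w : R * R :=
  (1 / 4 - Num.max (w z0) 0,
   2 * ((Num.max (w z1) 0 - Num.max (w z2) 0) * Num.max (w z0) 0)).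

Lemma max0l (a : R) : 0 <= a -> Num.max a 0 = a.
Proof. by move=> a0; rewrite max_l. Qed.

Lemma max0r (a : R) : a <= 0 -> Num.max a 0 = 0.
Proof. by move=> a0; rewrite max_r. Qed.

Lemma handle_outside w : w z0 <= 0 -> handle_coord w = (1 / 4, 0).
Proof. by move=> w0; rewrite /handle_coord (max0r w0) subr0 !mulr0. Qed.

Lemma handle_inside w : 0 < w z0 -> balanced handle_losing w ->
  [/\ forall j, w (tail j) <= 0,
      w z0 + Num.max (w z1) 0 + Num.max (w z2) 0 = 1 / 2 &
      w z1 <= 0 \/ w z2 <= 0].
Proof.
move=> w0 [wp _ sp _]; move: wp; rewrite /handle_losing !inE w0.
move=> /andP[/forallP tw]; rewrite negb_and -!leNgt => T12.
have {}tw j : w (tail j) <= 0 by have := tw j; rewrite inE -leNgt.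
split=> //; last exact/orP.
move: sp; rewrite big_colors (max0l (ltW w0)) [X in _ + X]big1 ?addr0// => j _.
exact: max0r.
Qed.

Lemma handle_inside_square w : 0 < w z0 -> balanced handle_losing w ->
  csqrt_of (Num.max (w z1) 0 - Num.max (w z2) 0, w z0) (handle_coord w).
Proof.
move=> w0 /(handle_inside w0)[_ + T12]; rewrite /handle_coord (max0l (ltW w0)).
by case: T12 => /max0r ->; move: (Num.max _ _) => a e; split=> //=; nra.
Qed.

Lemma handle_coord_neq0 w : balanced handle_losing w ->
  (handle_coord w).1 ^+ 2 + (handle_coord w).2 ^+ 2 != 0.
Proof.
move=> wB; apply/negP; rewrite paddr_eq0 ?sqr_ge0// !sqrf_eq0 => /andP[/eqP h1 /eqP h2].
have [w0|w0] := leP (w z0) 0; first by move: h1; rewrite handle_outside//=; lra.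
have [e1 e2] := handle_inside_square w0 wB.
move: e1 e2; rewrite h1 h2 /= => e1 e2.
have : w z0 ^+ 2 * (w z0 ^+ 2) = 0 by nra.
by apply/eqP; rewrite !mulf_neq0// gt_eqF.
Qed.

Let cmul (v v' : R * R) : R * R :=
  (v.1 * v'.1 - v.2 * v'.2, v.1 * v'.2 + v.2 * v'.1).

(** The scalar product of v with the position of w in the plane of the loop
    through 1, 0 and 2. *)
Let pairing v w : R := v.1 * (w z1 - w z2) + v.2 * w z0.

Lemma csqrt_quarter (v : R * R) : csqrt_of v (1 / 4, 0) -> v = (1 / 2, 0) \/ v = (- (1 / 2), 0).
Proof.
move=> v14; have half : csqrt_of (1 / 2, 0) ((1 / 4, 0) : R * R).
  by split=> /=; [field|ring].
by have [->|->] := csqrt_unique half v14; [left|right; rewrite /= oppr0].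
Qed.

(** In the handle, the product of the square roots is a real multiple of the vector
    (a_1 - a_2, a_0), whose scalar product with (w 1 - w 2, w 0) is positive. *)
Lemma pairing_inside w va vb : 0 < w z0 -> balanced handle_losing w ->
  csqrt_of va (handle_coord w) -> csqrt_of vb (handle_coord (fun i => - w i)) ->
  pairing (cmul va vb) w != 0.
Proof.
move=> w0 wB vaE; rewrite handle_outside ?oppr_le0 ?(ltW w0)// => /csqrt_quarter vbE.
have va' := csqrt_unique (handle_inside_square w0 wB) vaE.
have [_ _ T12] := handle_inside w0 wB.
pose D := (Num.max (w z1) 0 - Num.max (w z2) 0) * (w z1 - w z2) + w z0 ^+ 2.
have D0 : 0 < D.
  have w02 : 0 < w z0 ^+ 2 by rewrite exprn_gt0.
  rewrite ltr_wpDl//; case: T12 => wi; rewrite (max0r wi).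
    have [w2|/ltW w2] := leP (w z2) 0; first by rewrite subrr mul0r.
    by rewrite sub0r mulNr -mulrN opprB mulr_ge0// subr_ge0 (le_trans wi).
  have [w1|/ltW w1] := leP (w z1) 0; first by rewrite subrr mul0r.
  by rewrite subr0 mulr_ge0// subr_ge0 (le_trans wi).
rewrite /pairing /cmul; have D2 : D / 2 != 0 by rewrite gt_eqF// divr_gt0.
case: va' vbE => -> [] -> /=; [|rewrite -oppr_eq0|rewrite -oppr_eq0|];
  by apply: contra D2 => /eqP h; apply/eqP; rewrite -[RHS]h /D; field.
Qed.

Lemma balanced_sum_head w : balanced handle_losing w ->
  (forall j, w (tail j) = 0) -> w z0 + w z1 + w z2 = 0.
Proof.
move=> [_ _ sp sn] tw; have : \sum_i w i = 0.
  have -> : \sum_i w i = \sum_i Num.max (w i) 0 - \sum_i Num.max (- w i) 0.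
    rewrite -sumrB; apply: eq_bigr => i _.
    have [wi|/ltW wi] := leP (w i) 0; first by rewrite sub0r max0l ?oppr_ge0// opprK.
    by rewrite max0r ?oppr_le0// subr0.
  by rewrite sp sn subrr.
by rewrite big_colors [X in _ + X]big1 ?addr0// => j _; rewrite tw.
Qed.

Lemma pairing_neq0 w va vb : balanced handle_losing w ->
  (forall j, w (tail j) = 0) ->
  csqrt_of va (handle_coord w) -> csqrt_of vb (handle_coord (fun i => - w i)) ->
  pairing (cmul va vb) w != 0.
Proof.
move=> wB tw vaE vbE; have [w0|w0|w0] := ltgtP (w z0) 0.
- have cmulC : cmul va vb = cmul vb va.
    by rewrite /cmul; congr pair; rewrite ?[va.1 * _]mulrC; ring.
  rewrite cmulC -oppr_eq0.
  have -> : - pairing (cmul vb va) w = pairing (cmul vb va) (fun i => - w i).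
    by rewrite /pairing; ring.
  apply: pairing_inside; rewrite ?oppr_gt0//; first exact: balancedN.
  by under [fun i => - - w i]funext do rewrite opprK.
- exact: pairing_inside.
- have [_ _ sp _] := wB.
  move: vaE vbE; rewrite !handle_outside ?w0 ?oppr0// => /csqrt_quarter va' /csqrt_quarter vb'.
  have s12 : w z1 + w z2 = 0.
    by have := balanced_sum_head wB tw; rewrite w0 add0r.
  have w12 : w z1 - w z2 != 0.
    apply/negP => /eqP d12; have w1 : w z1 = 0 by lra.
    have w2 : w z2 = 0 by lra.
    move: sp; rewrite big_colors w0 w1 w2 big1 ?max0l// => [|j _].
      by lra.
    by rewrite tw max0l.
  rewrite /pairing /cmul; have q0 : (w z1 - w z2) / 4 != 0.
    by rewrite mulf_neq0// invr_eq0 pnatr_eq0.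
  case: va' vb' => -> [] -> /=; [|rewrite -oppr_eq0|rewrite -oppr_eq0|];
    by apply: contra q0 => /eqP h; apply/eqP; rewrite -[RHS]h; field.
Qed.

(** The slope combines w 0, w 1 and w 2 with positive coefficients that depend on
    v, and reduces to the pairing when w 0 + w 1 + w 2 = 0. *)
Let slope (v : R * R) w : R :=
  (1 + `|v.1| + `|v.2|) * (w z0 + w z1 + w z2) + pairing v w.

(** If the tail of w is constant and positive, w 0, w 1 and w 2 must be
    nonpositive for the support of the positive part to be losing, and so is their
    combination with positive coefficients. *)
Lemma slope_le0 v w : balanced handle_losing w ->
  (forall j, w (tail j) = slope v w) -> slope v w <= 0.
Proof.
move=> wB tw; rewrite leNgt; apply/negP => k0.
have tail0 j : 0 < w (tail j) by rewrite tw.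
have w0 : w z0 <= 0.
  rewrite leNgt; apply/negP => /handle_inside /(_ wB)[/(_ (Ordinal n_gt0))].
  by rewrite leNgt tail0.
have [wp _ _ _] := wB; move: wp; rewrite /handle_losing !inE ltNge w0 /=.
move/implyP; have -> : [forall j, tail j \in [set i | 0 < w i]%SET].
  by apply/forallP => j; rewrite inE.
rewrite -!leNgt => /(_ isT)/andP[w1 w2].
move: k0; apply/negP; rewrite -leNgt /slope /pairing.
have := ler_norm v.1; have := ler_norm (- v.1); have := ler_norm (- v.2).
rewrite !normrN; have := normr_ge0 v.1; have := normr_ge0 v.2.
move: `|v.1| `|v.2| => a b b0 a0 hb ha' ha.
rewrite [leLHS](_ : _ = w z0 * (1 + a + b + v.2) + w z1 * (1 + a + b + v.1) +
  w z2 * (1 + a + b - v.1)); last by ring.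
have neg (p q : R) : p <= 0 -> 0 <= q -> p * q <= 0 by exact: mulr_le0_ge0.
have -> : 0 = 0 + 0 + 0 :> R by rewrite !addr0.
by apply: lerD; [apply: lerD|]; apply: neg => //; lra.
Qed.

Lemma slopeN v w : slope v (fun i => - w i) = - slope v w.
Proof. by rewrite /slope /pairing; ring. Qed.

(** The slope vanishes, by the previous argument for w and for - w; so w lives on
    the colors 0, 1 and 2, where the pairing is not 0. *)
Lemma slope_tail va vb w : balanced handle_losing w ->
  csqrt_of va (handle_coord w) -> csqrt_of vb (handle_coord (fun i => - w i)) ->
  ~ forall j, w (tail j) = slope (cmul va vb) w.
Proof.
move=> wB vaE vbE tw; have k0 : slope (cmul va vb) w = 0.
  apply/eqP; rewrite eq_le slope_le0//= -oppr_le0 -slopeN.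
  by apply: slope_le0 => [|j]; [exact: balancedN|rewrite slopeN tw].
have {}tw j : w (tail j) = 0 by rewrite tw.
have /eqP := pairing_neq0 wB tw vaE vbE; apply.
move: k0; rewrite /slope.
by rewrite balanced_sum_head// mulr0 add0r.
Qed.

Section NoBalancedMap.
Hypothesis n_gt1 : (1 < n)%N.
Variable y : 'rV[R]_n -> I -> R.
Hypothesis cy : forall i, continuous (fun x => y x i).
Hypothesis yB : forall x, balanced handle_losing (y x).
Hypothesis yN : forall x, l1 x = 1 -> y (- x) = (fun i => - y x i).

Lemma l1_cube (x : 'rV[R]_n) : l1 x = 1 -> cube x.
Proof.
move=> x1 j; rewrite -x1 /l1 (bigD1 j)//= lerDl.
by apply: sumr_ge0.
Qed.

Lemma cont_handle_coord (Y : 'rV[R]_n -> I -> R) :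
  (forall i, continuous (fun x => Y x i)) ->
  continuous (fun x => (handle_coord (Y x)).1) /\
  continuous (fun x => (handle_coord (Y x)).2).
Proof.
move=> cY; have cmax i : continuous (fun x => Num.max (Y x i) 0).
  by apply: cont_maxr => //; exact: cont_cst.
split; first by apply: cont_sub => //; exact: cont_cst.
apply: cont_mul; first exact: cont_cst.
by apply: cont_mul => //; exact: cont_sub.
Qed.

(** The square roots va and vb of the handle coordinates of y x and of - y x
    exist because the ball is simply connected. On the boundary sphere they are
    exchanged by the antipode up to a sign, which is constant along a path from x
    to - x, so that their product is an even function. *)
Lemma even_square_root : exists va vb : 'rV[R]_n -> R * R,
  [/\ [/\ continuous (fun x => (va x).1), continuous (fun x => (va x).2),
          continuous (fun x => (vb x).1) & continuous (fun x => (vb x).2)],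
      forall x, cube x -> csqrt_of (va x) (handle_coord (y x)),
      forall x, cube x -> csqrt_of (vb x) (handle_coord (fun i => - y x i)) &
      forall x, l1 x = 1 -> cmul (va (- x)) (vb (- x)) = cmul (va x) (vb x)].
Proof.
have neg_sq (a b : R) : 0 < a ^+ 2 + b ^+ 2 -> - a * a + - b * b < 0.
  by move=> ?; lra.
have cyN i : continuous (fun x => - y x i) by exact: cont_opp.
have [c1 c2] := cont_handle_coord cy.
have [c3 c4] := cont_handle_coord (Y := fun x i => - y x i) cyN.
have [p [q [cp cq pq]]] := has_csqrt_cube c1 c2 (fun x => handle_coord_neq0 (yB x)).
have [p' [q' [cp' cq' pq']]] := has_csqrt_cube c3 c4
  (fun x => handle_coord_neq0 (balancedN (yB x))).
pose va x := (p x, q x); pose vb x := (p' x, q' x).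
have vaP x : cube x -> csqrt_of (va x) (handle_coord (y x)).
  by move=> /pq; case: (handle_coord _).
have vbP x : cube x -> csqrt_of (vb x) (handle_coord (fun i => - y x i)).
  by move=> /pq'; case: (handle_coord _).
exists va, vb; split=> // x x1.
have l1N (z : 'rV[R]_n) : l1 z = 1 -> l1 (- z) = 1.
  by move=> <-; apply: eq_bigr => k _; rewrite mxE normrN.
have va_opp z : l1 z = 1 -> va (- z) = vb z \/ va (- z) = (- (vb z).1, - (vb z).2).
  move=> zS; apply: csqrt_unique (vbP z (l1_cube zS)) _.
  by rewrite -(yN zS); apply: vaP; exact/l1_cube/l1N.
have sq_gt0 z : l1 z = 1 -> 0 < (vb z).1 ^+ 2 + (vb z).2 ^+ 2.
  move=> zS; rewrite lt_neqAle addr_ge0 ?sqr_ge0// andbT eq_sym.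
  rewrite paddr_eq0 ?sqr_ge0// !sqrf_eq0; apply/negP => /andP[/eqP v1 /eqP v2].
  have [] := vbP z (l1_cube zS); rewrite v1 v2 mulr0 expr0n subr0 mulr0 => h1 h2.
  have := handle_coord_neq0 (balancedN (yB z)).
  by rewrite -h1 -h2 expr0n addr0 eqxx.
pose g z := (va (- z)).1 * (vb z).1 + (va (- z)).2 * (vb z).2.
have g_pos z : l1 z = 1 -> 0 < g z -> va (- z) = vb z.
  move=> zS; have [//|vE] := va_opp z zS; rewrite /g vE /=.
  by move/lt_trans/(_ (neg_sq _ _ (sq_gt0 z zS))); rewrite ltxx.
have g_neg z : l1 z = 1 -> ~ 0 < g z -> va (- z) = (- (vb z).1, - (vb z).2).
  move=> zS; have [vE|//] := va_opp z zS; rewrite /g vE => -[].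
  by rewrite -!expr2; exact: sq_gt0.
have g0 z : l1 z = 1 -> g z != 0.
  move=> zS; have [vE|vE] := va_opp z zS; rewrite /g vE /=.
    by rewrite -!expr2 gt_eqF// sq_gt0.
  by rewrite lt_eqF// neg_sq// sq_gt0.
have cg : continuous g.
  have copp (h : 'rV[R]_n -> R) : continuous h ->
      continuous (fun z : 'rV[R]_n => h (- z)).
    move=> ch z; apply: (@continuous_comp _ _ _ (fun u : 'rV[R]_n => - u) h).
      exact: oppr_continuous.
    exact: ch.
  by apply: cont_add; apply: cont_mul => //; exact: copp.
have xN1 := l1N x x1.
have vb_opp : va x = vb (- x) \/ va x = (- (vb (- x)).1, - (vb (- x)).2).
  by have := va_opp _ xN1; rewrite opprK.
have [gx|gx] := pselect (0 < g x).
  have := g_pos _ xN1 (sphere_antipode_gt0 n_gt1 cg g0 x1 gx); rewrite opprK => ->.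
  by rewrite (g_pos _ x1 gx) /cmul; congr pair; ring.
have gNx : ~ 0 < g (- x).
  by move=> /(sphere_antipode_gt0 n_gt1 cg g0 xN1); rewrite opprK.
have := g_neg _ xN1 gNx; rewrite opprK => ->.
by rewrite (g_neg _ x1 gx) /cmul /=; congr pair; ring.
Qed.

(** Subtracting the slope, for v the even square root, from the tail coordinates
    gives an odd map without zeros, contradicting Borsuk-Ulam. *)
Lemma no_balanced_map : False.
Proof.
have [va [vb [[c1 c2 c3 c4] vaP vbP vN]]] := even_square_root.
pose v x := cmul (va x) (vb x).
have cv1 : continuous (fun x => (v x).1).
  by apply: cont_sub; exact: cont_mul.
have cv2 : continuous (fun x => (v x).2).
  by apply: cont_add; exact: cont_mul.
have cslope : continuous (fun x => slope (v x) (y x)).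
  apply: cont_add; last first.
    by apply: cont_add; apply: cont_mul => //; exact: cont_sub.
  apply: cont_mul; last by apply: cont_add => //; exact: cont_add.
  apply: cont_add; last exact: cont_norm.
  by apply: cont_add; [exact: cont_cst|exact: cont_norm].
pose G j x := y x (tail j) - slope (v x) (y x).
have [x xC G0] : exists2 x, cube x & forall j, G j x = 0.
  apply: borsuk_ulam_ball => [j|x x1 j]; first by apply: cont_sub.
  by rewrite /G (yN x1) /v vN// slopeN opprK opprB addrC.
apply: (slope_tail (yB x) (vaP x xC) (vbP x xC)) => j.
by apply/eqP; rewrite -subr_eq0; apply/eqP; exact: G0.
Qed.

End NoBalancedMap.

End Handle.

(** * The two properties of the handle graph *)

Section HandleGraph.
Variables (R : realType) (r : nat) (r_gt1 : (1 < r)%N).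

Let n := (2 * r).-2.
Let nE : n.+2 = (2 * r)%N.
Proof. by rewrite /n; lia. Qed.
Let n_gt1 : (1 < n)%N.
Proof. by rewrite /n; lia. Qed.
Let n_gt0 : (0 < n)%N := ltnW n_gt1.

Definition handle_graph := selfdual_graph (@handle_losing n).

Lemma handle_graph_topologically_chromatic :
  topologically_chromatic R (2 * r) handle_graph.
Proof.
rewrite /topologically_chromatic -nE -addn1 natrD addrK.
exact: selfdual_graph_coind (handle_losingS n_gt0) (@handle_losingC n) _.
Qed.

Lemma handle_graph_not_strongly_chromatic :
  ~ strongly_topologically_chromatic R (2 * r) handle_graph.
Proof.
rewrite /strongly_topologically_chromatic -nE -addn2 natrD addrK.
move=> /coind_ball[f [cf fN]].
apply: (@no_balanced_map n n_gt0 R n_gt1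
  (fun x => color_weight (set_val (f x)))) => [i|x|x x1].
- move=> x; apply: (@continuous_comp _ _ _ f
    (fun p => color_weight (set_val p : box_space handle_graph R) i)).
    exact: cf.
  move=> p; apply: (@continuous_comp _ _ _
    (fun p : hom_space handle_graph R => set_val p : box_space handle_graph R)
    (fun p => color_weight p i)).
    exact: continuous_set_val.
  exact: cont_color_weight.
- exact: hom_set_balanced (handle_losingS n_gt0) _ (set_valP (f x)).
- by apply/funext => i; rewrite (fN x x1) color_weightN.
Qed.

End HandleGraph.

Theorem corollary8 (R : realType) (r : nat) (r_ge1 : (1 <= r)%N) :
  [/\ exists G : sgraph,
        [/\ topologically_chromatic R (2 * r)%N G,
            local_chromatic_number G = (r + 1)%N &
            exists c : G -> nat,
              [/\ proper_coloring c,
                  num_colors c = (2 * r + 1)%N &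
                  local_value c = (r + 1)%N]],
      (2 <= r)%N ->
        ~ (forall G : sgraph, topologically_chromatic R (2 * r)%N G ->
             strongly_topologically_chromatic R (2 * r)%N G) &
      ~ (forall G : sgraph, topologically_chromatic R (2 * r)%N G ->
           (r + 2 <= local_chromatic_number G)%N)].
Proof.
have topG := majority_graph_topologically_chromatic R r_ge1.
have [lv psi] := majority_graph_local_chromatic R r_ge1.
split.
- exists (majority_graph r); split=> //; exists (@vertex_color r); split=> //.
    exact: vertex_color_proper.
  exact: num_vertex_colors.
- move=> r2 strong; apply: (@handle_graph_not_strongly_chromatic R r r2).
  exact/strong/handle_graph_topologically_chromatic.
- move=> /(_ _ topG); rewrite psi; lia.
Qed.
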